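(* Let $(M,\omega,\mathbb{T})$ be a compact symplectic toric manifold of real dimension $2m$ and let $J_0\in K_\omega^{\mathbb{T}}(M)$ be an $\omega$-compatible $\mathbb{T}$-invariant complex structure, given in its momentum-angle coordinates $(\mu^j,t^j)$ on $\mathring M$ by $$J_0\frac{\partial}{\partial\mu^j}=\sum_{k=1}^m\frac{\partial^2\tau}{\partial\mu^j\partial\mu^k}\frac{\partial}{\partial t^k},$$ with $\tau$ a smooth strictly convex function on $\mathring\Delta$. Given an antisymmetric matrix $C$, define a family of matrix-valued functions $\mathring\Psi(t)$ ($t\in\mathbb{R}$) on $\mathring\Delta$ by $$\mathring\Psi_{jk}(t)=\frac{\partial^2\tau}{\partial\mu^j\partial\mu^k}+tC_{jk},$$ and let $\mathring J_t\in DGK_\omega^{\mathbb{T}}(\mathring M)$ be the corresponding family $$\mathring J_t=\sum_{i,j=1}^m\mathring\Psi_{ij}(t)\frac{\partial}{\partial t^i}\otimes d\mu^j-\sum_{i,j=1}^m(\mathring\Psi(t)^{-1})_{ij}\frac{\partial}{\partial\mu^i}\otimes dt^j.$$ For sufficiently small values of $|t|$, $\mathring J_t$ is the restriction to $\mathring M$ of a family $J_t\in DGK_\omega^{\mathbb{T}}(M)$.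
   Context: Toric setting. $M$ is compact connected, $\mathbb{T}$ is an $m$-torus with Lie algebra $\mathfrak{t}$ acting effectively and in a hamiltonian fashion on $(M,\omega)$ with moment map $\mu:M\to\mathfrak{t}^*$; $\Delta=\mu(M)$ is the moment polytope, $\mathring\Delta$ its interior, $\mathring M=\mu^{-1}(\mathring\Delta)$. A basis $(\xi_j)$ of $\mathfrak{t}$ is fixed; $K_j=\xi_j^\sharp$ is the induced vector field, $\mu^j=\langle\mu,\xi_j\rangle$, $\omega(K_j,\cdot)=-d\mu^j$. Strictly convex means positive definite Hessian. Structures (with $N=M$ or $\mathring M$). $J$ is $\omega$-tamed if $\omega(X,JX)>0$ for $X\ne0$; $J^{*_\omega}$ is defined by $\omega(JX,Y)=\omega(X,J^{*_\omega}Y)$. Generalized Kähler structures of symplectic type are identified with $\omega$-tamed almost complex structures $J$ such that both $J$ and $J^{*_\omega}$ are integrable; $GK_\omega^{\mathbb{T}}(N)$ is the set of $\mathbb{T}$-invariant ones on $N$, and $K_\omega^{\mathbb{T}}(N)$ the subset with $J^{*_\omega}=-J$ (i.e. $\omega$-compatible complex structures). With $\mathcal{K}$ the distribution on $\mathring M$ spanned by the $K_j$, $DGK_\omega^{\mathbb{T}}(N)=\{J\in GK_\omega^{\mathbb{T}}(N):J^{*_\omega}\mathcal{K}=J\mathcal{K}\text{ on }\mathring M\}$. Momentum-angle coordinates of $J_0$: around each point of $\mathring M$ there are local $J_0$-holomorphic coordinates $u^j+it^j$ with $\partial/\partial u^j=-J_0K_j$, $\partial/\partial t^j=K_j$; replacing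 $u^j$ by $\mu^j$ gives coordinates $(\mu^j,t^j)$ with $\omega=\sum_jd\mu^j\wedge dt^j$; the coordinate fields and the forms $d\mu^j,dt^j$ are globally defined on $\mathring M$. *)

(* Defs.v *)
From HB Require Import structures.
From mathcomp Require Import all_boot all_order all_algebra.
From mathcomp Require Import all_classical all_reals all_analysis.
Import Order.TTheory GRing.Theory Num.Theory.
Import numFieldNormedType.Exports.

Set Implicit Arguments.
Unset Strict Implicit.
Unset Printing Implicit Defensive.

Local Open Scope classical_set_scope.
Local Open Scope ring_scope.

(* Vectors are rows: a linear map f acts by v |-> v *m f, a bilinear form b is *)
(* (v, w) |-> v *m b *m w^T, a covector is a column.                           *)

Section Calculus.
Context {R : realType}.

Definition iter_derive (V W : normedModType R) (vs : seq V) (f : V -> W) :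
    V -> W :=
  foldr (fun v g => 'D_v g) f vs.

(* C^oo on D, for D open: the iterated directional derivatives of all orders *)
(* exist and are differentiable at the points of D.                          *)
Definition smooth_on (V W : normedModType R) (D : set V) (f : V -> W) : Prop :=
  forall (vs : seq V) (x : V), D x -> differentiable (iter_derive vs f) x.

Definition lie_bracket n (X Y : 'rV[R]_n -> 'rV[R]_n) (y : 'rV[R]_n) :
    'rV[R]_n :=
  'D_(X y) Y y - 'D_(Y y) X y.

(* The general term J J [X, Y] is written - [X, Y], as J J = - 1. *)
Definition nijenhuis n (J : 'rV[R]_n -> 'M[R]_n)
    (X Y : 'rV[R]_n -> 'rV[R]_n) (y : 'rV[R]_n) : 'rV[R]_n :=
  let JX := fun z => X z *m J z in
  let JY := fun z => Y z *m J z in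
  lie_bracket JX JY y - lie_bracket JX Y y *m J y
    - lie_bracket X JY y *m J y - lie_bracket X Y y.

Definition bilin n (b : 'M[R]_n) (v w : 'rV[R]_n) : R :=
  (v *m b *m w^T) 0 0.

(* Constant vector fields commute, so on them the exterior derivative is the *)
(* cyclic sum of the directional derivatives.                                *)
Definition closed_form n (D : set 'rV[R]_n) (w : 'rV[R]_n -> 'M[R]_n) : Prop :=
  forall (y a b c : 'rV[R]_n), D y ->
    'D_a (fun z => bilin (w z) b c : R^o) y
    + 'D_b (fun z => bilin (w z) c a : R^o) y
    + 'D_c (fun z => bilin (w z) a b : R^o) y = 0.

Definition hessian m (tau : 'rV[R]_m -> R^o) (x : 'rV[R]_m) : 'M[R]_m :=
  \matrix_(j, k) 'D_(delta_mx 0 j) ('D_(delta_mx 0 k) tau) x.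

Definition strictly_convex_on m (D : set 'rV[R]_m) (tau : 'rV[R]_m -> R^o) :
    Prop :=
  forall x v, D x -> v != 0 -> 0 < bilin (hessian tau x) v v.

End Calculus.

Section Manifold.
Context {R : realType}.

(* cinv is only relevant on the open set cmap @` cdom. *)
Record chart (n : nat) (M : topologicalType) := Chart {
  cdom : set M;
  cmap : M -> 'rV[R]_n;
  cinv : 'rV[R]_n -> M;
  cdom_open : open cdom;
  cimg_open : open (cmap @` cdom);
  cmap_continuous : {within cdom, continuous cmap};
  cinv_continuous : {within cmap @` cdom, continuous cinv};
  cmapK : forall p, cdom p -> cinv (cmap p) = p
}.

(* The atlas is indexed by the points of M, chart_at p being a chart around p. *)
(* The components in chart_at p identify the tangent space at p with R^n;      *)
(* hence a vector field is a map M -> 'rV_n, a field of endomorphisms or of    *)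
(* bilinear forms a map M -> 'M_n.                                             *)
Record atlas (n : nat) (M : topologicalType) := Atlas {
  chart_at : M -> chart n M;
  chart_at_mem : forall p, cdom (chart_at p) p;
  chart_compat : forall p q,
    smooth_on (cmap (chart_at p) @` (cdom (chart_at p) `&` cdom (chart_at q)))
              (cmap (chart_at q) \o cinv (chart_at p))
}.

Context {n : nat} {M : topologicalType}.
Variable A : atlas n M.
Implicit Types (p q x : M) (N : set M).

Definition in_chart q N : set 'rV[R]_n :=
  cmap (chart_at A q) @` (cdom (chart_at A q) `&` N).

(* Change of components of the vectors at x, from chart_at p to chart_at q. *)
Definition transition p q x : 'M[R]_n :=
  jacobian (cmap (chart_at A q) \o cinv (chart_at A p)) (cmap (chart_at A p) x).

Definition smooth_map_on (W : normedModType R) N (f : M -> W) : Prop :=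
  forall q, smooth_on (in_chart q N) (f \o cinv (chart_at A q)).

Definition differential k (f : M -> 'rV[R]_k) p : 'M[R]_(n, k) :=
  jacobian (f \o cinv (chart_at A p)) (cmap (chart_at A p) p).

Definition tangent_map (f : M -> M) p : 'M[R]_n :=
  jacobian (cmap (chart_at A (f p)) \o f \o cinv (chart_at A p))
           (cmap (chart_at A p) p).

Definition endo_in_chart (J : M -> 'M[R]_n) q (y : 'rV[R]_n) : 'M[R]_n :=
  let x := cinv (chart_at A q) y in
  transition q x x *m J x *m transition x q x.

Definition form_in_chart (w : M -> 'M[R]_n) q (y : 'rV[R]_n) : 'M[R]_n :=
  let x := cinv (chart_at A q) y in
  transition q x x *m w x *m (transition q x x)^T.

Definition smooth_endo N (J : M -> 'M[R]_n) : Prop :=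
  forall q, smooth_on (in_chart q N) (endo_in_chart J q).

Definition integrable_acs N (J : M -> 'M[R]_n) : Prop :=
  forall q (X Y : 'rV[R]_n -> 'rV[R]_n),
    smooth_on (in_chart q N) X -> smooth_on (in_chart q N) Y ->
    forall y, in_chart q N y -> nijenhuis (endo_in_chart J q) X Y y = 0.

Record symplectic_form (w : M -> 'M[R]_n) : Prop := SymplecticForm {
  symp_smooth : forall q, smooth_on (in_chart q setT) (form_in_chart w q);
  symp_alt : forall p, (w p)^T = - w p;
  symp_nondeg : forall p, w p \in unitmx;
  symp_closed : forall q, closed_form (in_chart q setT) (form_in_chart w q)
}.

(* By the inverse function theorem x is then a diffeomorphism from V onto an *)
(* open subset of R^n.                                                       *)
Record local_coordinates (V : set M) (x : M -> 'rV[R]_n) : Prop :=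
  LocalCoordinates {
  lc_open : open V;
  lc_smooth : smooth_map_on V x;
  lc_inj : forall p q, V p -> V q -> x p = x q -> p = q;
  lc_immersion : forall p, V p -> differential x p \in unitmx
}.

(* The vectors d/dx^a, dual to the covectors dx^b. *)
Definition coord_vector (x : M -> 'rV[R]_n) (a : 'I_n) p : 'rV[R]_n :=
  row a (invmx (differential x p)).

Definition coord_covector k (x : M -> 'rV[R]_k) (a : 'I_k) p : 'cV[R]_n :=
  col a (differential x p).

(* The torus is R^m / Lambda, where R^m is its Lie algebra, identified by the  *)
(* fixed basis (xi_j), and the lattice Lambda, the kernel of exp, is spanned   *)
(* by the rows of L. Its action is given as act theta = the action of          *)
(* exp theta; smoothness on R^m x M amounts to smoothness on (R^m/Lambda) x M. *)
Definition in_lattice m (L : 'M[R]_m) (theta : 'rV[R]_m) : Prop :=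
  exists z : 'rV[int]_m, theta = map_mx intr z *m L.

Record effective_torus_action m (L : 'M[R]_m) (act : 'rV[R]_m -> M -> M) :
    Prop := EffectiveTorusAction {
  lattice_full : L \in unitmx;
  act0 : forall p, act 0 p = p;
  actD : forall theta eta p, act (theta + eta) p = act theta (act eta p);
  act_lattice : forall theta p, in_lattice L theta -> act theta p = p;
  act_effective : forall theta, (forall p, act theta p = p) ->
    in_lattice L theta;
  act_continuous : continuous (fun z : 'rV[R]_m * M => act z.1 z.2);
  act_smooth : forall q r,
    smooth_on
      [set z : 'rV[R]_m * 'rV[R]_n | in_chart q setT z.2 /\
         cdom (chart_at A r) (act z.1 (cinv (chart_at A q) z.2))]
      (fun z => cmap (chart_at A r) (act z.1 (cinv (chart_at A q) z.2)))
}.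

(* K_j, the vector field induced by xi_j. *)
Definition induced_field m (act : 'rV[R]_m -> M -> M) (j : 'I_m) p : 'rV[R]_n :=
  derive1 (fun s : R => cmap (chart_at A p) (act (s *: delta_mx 0 j) p)) 0.

(* The components of mu in the basis dual to (xi_j) are the functions mu^j. *)
Record moment_map m (w : M -> 'M[R]_n) (act : 'rV[R]_m -> M -> M)
    (mu : M -> 'rV[R]_m) : Prop := MomentMap {
  mm_smooth : smooth_map_on setT mu;
  mm_invariant : forall theta p, mu (act theta p) = mu p;
  mm_hamiltonian : forall j p v,
    bilin (w p) (induced_field act j p) v = - (v *m coord_covector mu j p) 0 0
}.

End Manifold.

Record toric_manifold (R : realType) (m : nat) (M : topologicalType) :=
  ToricManifold {
  tm_atlas : @atlas R (m + m) M;
  tm_omega : M -> 'M[R]_(m + m);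
  tm_lattice : 'M[R]_m;
  tm_act : 'rV[R]_m -> M -> M;
  tm_mu : M -> 'rV[R]_m;
  tm_hausdorff : hausdorff_space M;
  tm_compact : compact [set: M];
  tm_connected : connected [set: M];
  tm_symplectic : symplectic_form tm_atlas tm_omega;
  tm_action : effective_torus_action tm_atlas tm_lattice tm_act;
  tm_act_symplectic : forall theta p v w,
    bilin (tm_omega (tm_act theta p))
          (v *m tangent_map tm_atlas (tm_act theta) p)
          (w *m tangent_map tm_atlas (tm_act theta) p)
    = bilin (tm_omega p) v w;
  tm_moment : moment_map tm_atlas tm_omega tm_act tm_mu
}.

Section ToricStructures.
Context {R : realType} {m : nat} {M : topologicalType}.
Variable T : toric_manifold R m M.

Definition polytope : set 'rV[R]_m := range (tm_mu T).

Definition M_int : set M := tm_mu T @^-1` interior polytope.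

Definition K (j : 'I_m) (p : M) : 'rV[R]_(m + m) :=
  induced_field (tm_atlas T) (tm_act T) j p.

(* Its row space is the fibre at p of the distribution spanned by the K_j. *)
Definition K_span (p : M) : 'M[R]_(m, m + m) := \matrix_j K j p.

Definition omega_adj (J : M -> 'M[R]_(m + m)) (p : M) : 'M[R]_(m + m) :=
  (invmx (tm_omega T p) *m J p *m tm_omega T p)^T.

Lemma omega_adjP J p v w :
  bilin (tm_omega T p) (v *m J p) w = bilin (tm_omega T p) v (w *m omega_adj J p).
Proof.
have wU := symp_nondeg (tm_symplectic T) p.
by rewrite /bilin /omega_adj trmx_mul trmxK !mulmxA mulmxK.
Qed.

(* Here and below, N stands for M or M_int. *)
Record GK (N : set M) (J : M -> 'M[R]_(m + m)) : Prop := GKStructure {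
  gk_smooth : smooth_endo (tm_atlas T) N J;
  gk_square : forall p, N p -> J p *m J p = - 1%:M;
  gk_tamed : forall p v, N p -> v != 0 -> 0 < bilin (tm_omega T p) v (v *m J p);
  gk_integrable : integrable_acs (tm_atlas T) N J;
  gk_integrable_adj : integrable_acs (tm_atlas T) N (omega_adj J);
  gk_invariant : forall theta p, N p ->
    J p *m tangent_map (tm_atlas T) (tm_act T theta) p
    = tangent_map (tm_atlas T) (tm_act T theta) p *m J (tm_act T theta p)
}.

Definition Kahler (N : set M) (J : M -> 'M[R]_(m + m)) : Prop :=
  GK N J /\ forall p, N p -> omega_adj J p = - J p.

Definition DGK (N : set M) (J : M -> 'M[R]_(m + m)) : Prop :=
  GK N J /\
  forall p, M_int p -> (K_span p *m omega_adj J p == K_span p *m J p)%MS.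

Record momentum_angle_coordinates (J0 : M -> 'M[R]_(m + m)) (V : set M)
    (u t : M -> 'rV[R]_m) : Prop := MomentumAngleCoordinates {
  ma_sub : V `<=` M_int;
  ma_complex : local_coordinates (tm_atlas T) V (fun p => row_mx (u p) (t p));
  (* d(u^j + i t^j) o J0 = i d(u^j + i t^j) *)
  ma_holo_re : forall p j, V p ->
    J0 p *m coord_covector (tm_atlas T) u j p
    = - coord_covector (tm_atlas T) t j p;
  ma_holo_im : forall p j, V p ->
    J0 p *m coord_covector (tm_atlas T) t j p
    = coord_covector (tm_atlas T) u j p;
  ma_du : forall p j, V p ->
    coord_vector (tm_atlas T) (fun p => row_mx (u p) (t p)) (lshift m j) p
    = - (K j p *m J0 p);
  ma_dt : forall p j, V p ->
    coord_vector (tm_atlas T) (fun p => row_mx (u p) (t p)) (rshift m j) p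
    = K j p;
  ma_symplectic :
    local_coordinates (tm_atlas T) V (fun p => row_mx (tm_mu T p) (t p))
}.

(* The global fields d/dmu^j, d/dt^j, dt^j on M_int which are, around each     *)
(* point, those of a system of momentum-angle coordinates (mu, t) of J0.       *)
Record momentum_angle_frame (J0 : M -> 'M[R]_(m + m)) := MomentumAngleFrame {
  d_dmu : 'I_m -> M -> 'rV[R]_(m + m);
  d_dt : 'I_m -> M -> 'rV[R]_(m + m);
  dt : 'I_m -> M -> 'cV[R]_(m + m);
  frame_coordinates : forall p0, M_int p0 ->
    exists (V : set M) (u t : M -> 'rV[R]_m),
      [/\ V p0, momentum_angle_coordinates J0 V u t &
        forall p j, V p ->
        let mut := fun q => row_mx (tm_mu T q) (t q) in
        [/\ d_dmu j p = coord_vector (tm_atlas T) mut (lshift m j) p,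
            d_dt j p = coord_vector (tm_atlas T) mut (rshift m j) p &
            dt j p = coord_covector (tm_atlas T) mut (rshift m j) p]]
}.

Definition dmu (j : 'I_m) (p : M) : 'cV[R]_(m + m) :=
  coord_covector (tm_atlas T) (tm_mu T) j p.

Definition Psi (tau : 'rV[R]_m -> R^o) (C : 'M[R]_m) (s : R) (x : 'rV[R]_m) :
    'M[R]_m :=
  hessian tau x + s *: C.

(* The endomorphism X (x) alpha is alpha *m X in row-vector conventions. *)
Definition J_int (J0 : M -> 'M[R]_(m + m)) (F : momentum_angle_frame J0)
    (P : 'rV[R]_m -> 'M[R]_m) (p : M) : 'M[R]_(m + m) :=
  \sum_i \sum_j P (tm_mu T p) i j *: (dmu j p *m d_dt F i p)
  - \sum_i \sum_j invmx (P (tm_mu T p)) i j *: (dt F j p *m d_dmu F i p).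

End ToricStructures.

(* Main.v *)
(* Write G for the matrix g(K_i, K_j) and B = C (1 + t G C)^-1, which exists since
   G is positive semidefinite and C antisymmetric. Then J_t equals
     J_0 + t C_ij K_i (x) dmu^j + t B_ij J_0 K_i (x) (dmu^j o J_0)
   over the interior of the polytope, and the right-hand side is smooth on all of
   M. That it squares to -1, is tamed, and has omega-adjoint - J_(-t) is pointwise
   algebra, valid for every t. Its Nijenhuis tensor also vanishes at every point
   of M, without any density argument: K_i and J_0 K_i commute and preserve J_0,
   dmu^j is closed, and the derivatives J_0 K_k (G_ij) are symmetric in i, j, k. *)

Require Import Defs.
From HB Require Import structures.
From mathcomp Require Import all_boot all_order all_algebra.
From mathcomp Require Import all_classical all_reals all_analysis.
From mathcomp Require Import ring lra.
Import Order.TTheory GRing.Theory Num.Theory.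
Import numFieldNormedType.Exports.

Set Implicit Arguments.
Unset Strict Implicit.
Unset Printing Implicit Defensive.

Local Open Scope classical_set_scope.
Local Open Scope ring_scope.

(** * Smooth maps *)

(** The Hessian H of [tau], the fields d/dmu^j and the forms dt^j live only over the interior, so
    [J_int] cannot be extended term by term. The inverse G of H, however, makes sense on all of M,
    as do K_i, J_0 K_i, dmu^j and dmu^j o J_0. The Woodbury formula (H + tC)^-1 = G - t G B G
    confines the singular part of [J_int] to J_0 itself and expresses the rest through these global
    objects; this is the origin of B. Two structures must be integrable, J_t and its adjoint; as the
    adjoint is - J_(-t), one statement for all t covers both. At a point the Nijenhuis tensor
    depends only on the first jet of the structure. Geometry therefore enters through finitely many
    identities between values and first derivatives, obtained by differentiating torus invariance
    and from the symmetry of second derivatives of the moment map; the remainder is matrix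
    algebra. *)

Section MatrixDifferentiation.
Context {R : realType} {V : normedModType R}.

Lemma differentiable_entry m n (f : V -> 'M[R]_(m, n)) x i j :
  differentiable f x -> differentiable (fun y => f y i j : R^o) x.
Proof.
move=> df.
exact: (differentiable_comp (g := fun N : 'M[R]_(m, n) => N i j : R^o) df
  (differentiable_coord _ _ _)).
Qed.

Lemma differentiable_mxP m n (f : V -> 'M[R]_(m, n)) x :
  (forall i j, differentiable (fun y => f y i j : R^o) x) -> differentiable f x.
Proof.
move=> df.
have -> : f = \sum_(i < m) \sum_(j < n) (fun y => f y i j *: delta_mx i j).
  apply/funext => y; rewrite [LHS]matrix_sum_delta fct_sumE.
  by apply: eq_bigr => i _; rewrite fct_sumE.
by apply: differentiable_sum => i; apply: differentiable_sum => j;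
  apply: differentiableZl; exact: df.
Qed.

Lemma derive_entry m n (f : V -> 'M[R]_(m, n)) x v i j :
  differentiable f x -> 'D_v (fun y => f y i j : R^o) x = ('D_v f x) i j.
Proof.
by move=> df; rewrite derive_mx ?mxE//; exact: diff_derivable.
Qed.

Lemma derive_linear_dir (W : normedModType R) (f : V -> W) x a u v :
  differentiable f x -> 'D_(a *: u + v) f x = a *: 'D_u f x + 'D_v f x.
Proof. by move=> df; rewrite !deriveE// linearP. Qed.

(** The differential of [f] serves for [g], since the remainder at [x] only sees the germs. This
    lets formulas valid on an open chart domain be differentiated there. *)
Lemma differentiable_near_eq (W : normedModType R) (f g : V -> W) x :
  (\near x, f x = g x) -> differentiable f x -> differentiable g x.
Proof.
move=> fg /diff_locallyP[dc df].
have dg : g \o shift x = cst (g x) + 'd f x +o_ 0 id.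
  apply/eqaddoP => _/posnumP[e].
  have /eqaddoP/(_ e%:num)/(_ [gt0 of e%:num]) := df.
  apply: filter_app; near=> y; rewrite /= !fctE /=.
  have -> : f (y + x) = g (y + x).
    near: y; move: fg; rewrite (near_shift 0) subr0.
    by [].
  by rewrite (nbhs_singleton fg).
apply/diff_locallyP; rewrite (diff_unique dc dg); by [].
Unshelve. all: by end_near. Qed.

Lemma differentiable_mulmx m n p (f : V -> 'M[R]_(m, n)) (g : V -> 'M[R]_(n, p)) x :
  differentiable f x -> differentiable g x ->
  differentiable (fun y => f y *m g y) x.
Proof.
move=> df dg; apply: differentiable_mxP => i j.
have -> : (fun y => (f y *m g y) i j : R^o) =
    \sum_(k < n) ((fun y => f y i k : R^o) * (fun y => g y k j : R^o)).
  by apply/funext => y; rewrite mxE fct_sumE.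
by apply: differentiable_sum => k; apply: differentiableM;
  exact: differentiable_entry.
Qed.

Lemma derive_mulmx m n p (f : V -> 'M[R]_(m, n)) (g : V -> 'M[R]_(n, p)) x v :
  differentiable f x -> differentiable g x ->
  'D_v (fun y => f y *m g y) x = 'D_v f x *m g x + f x *m 'D_v g x.
Proof.
move=> df dg; apply/matrixP => i j.
rewrite -derive_entry; last exact: differentiable_mulmx.
have -> : (fun y => (f y *m g y) i j : R^o) =
    \sum_(k < n) ((fun y => f y i k : R^o) * (fun y => g y k j : R^o)).
  by apply/funext => y; rewrite mxE fct_sumE.
have dfe k : derivable (fun y => f y i k : R^o) x v.
  by apply: diff_derivable; exact: differentiable_entry.
have dge k : derivable (fun y => g y k j : R^o) x v.
  by apply: diff_derivable; exact: differentiable_entry.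
rewrite derive_sum; last by move=> k; exact: derivableM.
rewrite !mxE -big_split; apply: eq_bigr => k _ /=.
rewrite deriveM // !derive_entry //.
by rewrite addrC /GRing.scale /=; congr (_ + _); rewrite mulrC.
Qed.

End MatrixDifferentiation.

Section Smooth.
Context {R : realType} {V : normedModType R} (D : set V).
Hypothesis oD : open D.

Lemma near_open (P : V -> Prop) x : D x -> (forall y, D y -> P y) ->
  \forall y \near x, P y.
Proof.
by move=> Dx DP; apply: (filterS DP); exact: open_nbhs_nbhs.
Qed.

Lemma smooth_differentiable (W : normedModType R) (f : V -> W) x :
  smooth_on D f -> D x -> differentiable f x.
Proof. by move=> sf Dx; exact: (sf [::] x Dx). Qed.

Lemma smooth_on_derive (W : normedModType R) (f : V -> W) v :
  smooth_on D f -> smooth_on D ('D_v f).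
Proof.
(* [foldr] applies the last direction of the list first, hence [rcons]. *)
move=> sf vs x Dx; have := sf (rcons vs v) x Dx.
by rewrite /iter_derive foldr_rcons.
Qed.

(* Coinduction: the iterated derivatives never leave the class P. *)
Lemma smooth_on_coind (W : normedModType R) (P : (V -> W) -> Prop) (f : V -> W) :
  (forall g, P g -> forall x, D x -> differentiable g x) ->
  (forall g v, P g -> exists2 h, P h & forall x, D x -> 'D_v g x = h x) ->
  P f -> smooth_on D f.
Proof.
move=> Pd PD Pf vs.
suff [g Pg fg] : exists2 g, P g & forall x, D x -> iter_derive vs f x = g x.
  move=> x Dx; apply: (@differentiable_near_eq _ _ _ g); last exact: Pd.
  by apply: near_open => // y Dy; rewrite fg.
elim: vs => [|v vs [g Pg fg]]; first by exists f.
have [h Ph gh] := PD g v Pg; exists h => // x Dx.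
rewrite -gh //=; apply: near_eq_derive; exact: near_open.
Qed.

Lemma smooth_on_eq (W : normedModType R) (f g : V -> W) :
  (forall x, D x -> f x = g x) -> smooth_on D f -> smooth_on D g.
Proof.
move=> fg sf.
apply: (@smooth_on_coind W (fun g => exists2 f, smooth_on D f &
  forall x, D x -> f x = g x)); last by exists f.
- move=> {f fg sf} {}g [f sf fg] x Dx.
  apply: (@differentiable_near_eq _ _ _ f); last exact: smooth_differentiable.
  exact: near_open.
- move=> {f fg sf} {}g v [f sf fg]; exists ('D_v f).
    by exists ('D_v f) => //; exact: smooth_on_derive.
  move=> x Dx; apply: near_eq_derive; apply: near_open => // y Dy.
  by rewrite fg.
Qed.

Lemma smooth_on_cst (W : normedModType R) (a : W) : smooth_on D (fun=> a).
Proof.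
apply: (@smooth_on_coind W (fun g => exists a, g = cst a)); last by exists a.
- by move=> _ [b ->] x Dx; exact: differentiable_cst.
- move=> _ v [b ->]; exists (cst 0); first by exists 0.
  by move=> x Dx; rewrite derive_cst.
Qed.

(** The class to which [smooth_on_coind] is applied. The derivative of a product or of an inverse is
    a polynomial in functions of all these kinds, so the closure properties cannot be proved one at
    a time. *)
Inductive smooth_algebra : (V -> R^o) -> Prop :=
| SmoothGen f of smooth_on D f : smooth_algebra f
| SmoothAdd f g of smooth_algebra f & smooth_algebra g : smooth_algebra (f + g)
| SmoothMul f g of smooth_algebra f & smooth_algebra g : smooth_algebra (f * g)
| SmoothInv f of smooth_algebra f & (forall x, D x -> f x != 0) :
    smooth_algebra (fun x => (f x)^-1).

Lemma smooth_algebra_differentiable f x :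
  smooth_algebra f -> D x -> differentiable f x.
Proof.
move=> + Dx; elim => {f} [f sf|f g _ df _ dg|f g _ df _ dg|f _ df fn0].
- exact: smooth_differentiable.
- exact: differentiableD.
- exact: differentiableM.
- by apply: differentiableV => //; exact: fn0.
Qed.

Lemma smooth_algebra_smooth f : smooth_algebra f -> smooth_on D f.
Proof.
apply: (@smooth_on_coind _ smooth_algebra) => [g sg x Dx|h v sh].
  exact: smooth_algebra_differentiable.
have dv g x : smooth_algebra g -> D x -> derivable g x v.
  by move=> sf Dx; apply: diff_derivable; exact: smooth_algebra_differentiable.
elim: sh => {h} [p sp|p q sp [p' sp' pp'] sq [q' sq' qq']
                 |p q sp [p' sp' pp'] sq [q' sq' qq']|p sp [p' sp' pp'] pn0].
- by exists ('D_v p) => //; apply: SmoothGen; exact: smooth_on_derive.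
- exists (p' + q'); first exact: SmoothAdd.
  move=> x Dx; rewrite deriveD; [|exact: dv..].
  by rewrite pp' // qq'.
- exists (p * q' + q * p'); first by apply: SmoothAdd; exact: SmoothMul.
  move=> x Dx; rewrite deriveM; [|exact: dv..].
  by rewrite pp' // qq'.
- have sV := SmoothInv sp pn0.
  exists ((cst (-1) * ((fun x => (p x)^-1) * (fun x => (p x)^-1)) : V -> R^o) * p').
    apply: SmoothMul => //; apply: SmoothMul; last exact: SmoothMul.
    exact/SmoothGen/smooth_on_cst.
  move=> x Dx; rewrite deriveV; [|exact: pn0|exact: dv].
  rewrite pp' // -[RHS]/((-1 * ((p x)^-1 * (p x)^-1)) * p' x).
  by rewrite mulN1r -invfM -expr2.
Qed.

Lemma smooth_onD (f g : V -> R^o) : smooth_on D f -> smooth_on D g ->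
  smooth_on D (fun x => f x + g x : R^o).
Proof.
by move=> sf sg; apply: smooth_algebra_smooth; apply: SmoothAdd; exact: SmoothGen.
Qed.

Lemma smooth_onM (f g : V -> R^o) : smooth_on D f -> smooth_on D g ->
  smooth_on D (fun x => f x * g x : R^o).
Proof.
by move=> sf sg; apply: smooth_algebra_smooth; apply: SmoothMul; exact: SmoothGen.
Qed.

Lemma smooth_onV (f : V -> R^o) : smooth_on D f -> (forall x, D x -> f x != 0) ->
  smooth_on D (fun x => (f x)^-1 : R^o).
Proof.
by move=> sf fn0; apply: smooth_algebra_smooth; apply: SmoothInv => //; exact: SmoothGen.
Qed.

Lemma smooth_on_sum (I : Type) (r : seq I) (f : I -> V -> R^o) :
  (forall i, smooth_on D (f i)) -> smooth_on D (fun x => \sum_(i <- r) f i x : R^o).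
Proof.
move=> sf; elim: r => [|i r ih].
  by under eq_fun do rewrite big_nil; exact: smooth_on_cst.
by under eq_fun do rewrite big_cons; exact: smooth_onD.
Qed.

Lemma smooth_on_prod (I : Type) (r : seq I) (f : I -> V -> R^o) :
  (forall i, smooth_on D (f i)) -> smooth_on D (fun x => \prod_(i <- r) f i x : R^o).
Proof.
move=> sf; elim: r => [|i r ih].
  by under eq_fun do rewrite big_nil; exact: smooth_on_cst.
by under eq_fun do rewrite big_cons; exact: smooth_onM.
Qed.

Lemma smooth_on_entry m n (f : V -> 'M[R]_(m, n)) i j :
  smooth_on D f -> smooth_on D (fun x => f x i j : R^o).
Proof.
move=> sf.
apply: (@smooth_on_coind _ (fun g => exists2 f : V -> 'M[R]_(m, n),
  smooth_on D f & g = fun x => f x i j)); last by exists f.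
- move=> _ [g sg ->] x Dx; apply: differentiable_entry.
  exact: smooth_differentiable.
- move=> _ v [g sg ->]; exists (fun x => ('D_v g x) i j).
    by exists ('D_v g) => //; exact: smooth_on_derive.
  by move=> x Dx; apply: derive_entry; exact: smooth_differentiable.
Qed.

Lemma smooth_on_mx m n (f : V -> 'M[R]_(m, n)) :
  (forall i j, smooth_on D (fun x => f x i j : R^o)) -> smooth_on D f.
Proof.
apply: (@smooth_on_coind _ (fun f : V -> 'M[R]_(m, n) =>
   forall i j, smooth_on D (fun x => f x i j : R^o))).
- move=> g sg x Dx; apply: differentiable_mxP => i j.
  exact: smooth_differentiable.
- move=> g v sg; exists ('D_v g) => // i j.
  apply: smooth_on_eq (smooth_on_derive v (sg i j)) => x Dx.
  apply: derive_entry; apply: differentiable_mxP => k l.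
  exact: smooth_differentiable.
Qed.

Lemma smooth_on_addmx m n (f g : V -> 'M[R]_(m, n)) :
  smooth_on D f -> smooth_on D g -> smooth_on D (fun x => f x + g x).
Proof.
move=> sf sg; apply: smooth_on_mx => i j.
by under eq_fun do rewrite mxE; apply: smooth_onD; exact: smooth_on_entry.
Qed.

Lemma smooth_on_mulmx m n p (f : V -> 'M[R]_(m, n)) (g : V -> 'M[R]_(n, p)) :
  smooth_on D f -> smooth_on D g -> smooth_on D (fun x => f x *m g x).
Proof.
move=> sf sg; apply: smooth_on_mx => i j.
by under eq_fun do rewrite mxE; apply: smooth_on_sum => k; apply: smooth_onM;
  exact: smooth_on_entry.
Qed.

Lemma smooth_on_trmx m n (f : V -> 'M[R]_(m, n)) :
  smooth_on D f -> smooth_on D (fun x => (f x)^T).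
Proof.
move=> sf; apply: smooth_on_mx => i j.
by under eq_fun do rewrite mxE; exact: smooth_on_entry.
Qed.

Lemma smooth_on_scalemx m n a (f : V -> 'M[R]_(m, n)) :
  smooth_on D f -> smooth_on D (fun x => a *: f x).
Proof.
move=> sf; apply: smooth_on_mx => i j; under eq_fun do rewrite mxE.
by apply: smooth_onM; [exact: smooth_on_cst | exact: smooth_on_entry].
Qed.

Lemma smooth_on_det n (f : V -> 'M[R]_n) :
  smooth_on D f -> smooth_on D (fun x => \det (f x) : R^o).
Proof.
move=> sf; apply: smooth_on_sum => s.
apply: smooth_onM; first exact: smooth_on_cst.
by apply: smooth_on_prod => i; exact: smooth_on_entry.
Qed.

Lemma smooth_on_invmx n (f : V -> 'M[R]_n) :
  smooth_on D f -> (forall x, D x -> f x \in unitmx) ->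
  smooth_on D (fun x => invmx (f x)).
Proof.
move=> sf fU; apply: smooth_on_mx => i j.
apply: (@smooth_on_eq _ (fun x => (\det (f x))^-1 * cofactor (f x) j i)).
  by move=> x Dx; rewrite /invmx fU // !mxE.
apply: smooth_onM.
  apply: smooth_onV; first exact: smooth_on_det.
  by move=> x /fU; rewrite unitmxE unitfE.
apply: smooth_onM; first exact: smooth_on_cst.
apply: smooth_on_det; apply: smooth_on_mx => k l.
by under eq_fun do rewrite !mxE; exact: smooth_on_entry.
Qed.

End Smooth.

(** * Symmetry of second derivatives *)

Section Schwarz.
Context {R : realType} {V : normedModType R}.

Lemma is_derive_line (W : normedModType R) (f : V -> W) x u (s : R) :
  derivable f (x + s *: u) u ->
  is_derive s 1 (fun r : R => f (x + r *: u)) ('D_u f (x + s *: u)).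
Proof.
move=> df.
have E : (fun h => h^-1 *: (((fun r : R => f (x + r *: u)) \o shift s) (h *: 1)
    - f (x + s *: u))) =
    (fun h => h^-1 *: ((f \o shift (x + s *: u)) (h *: u) - f (x + s *: u))).
  apply/funext => h /=; congr (_ *: (f _ - _)).
  by rewrite -[h *: 1]/(h * 1) mulr1 scalerDl addrCA addrA.
by split; rewrite ?/derivable ?/derive E.
Qed.

Lemma MVT_line (f : V -> R^o) x u (h : R) : 0 < h ->
  (forall s, 0 <= s <= h -> differentiable f (x + s *: u)) ->
  exists2 c, 0 < c < h & f (x + h *: u) - f x = 'D_u f (x + c *: u) * h.
Proof.
move=> h0 df.
have dl s : 0 <= s <= h ->
    is_derive s 1 (fun r : R => f (x + r *: u)) ('D_u f (x + s *: u)).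
  by move=> sh; apply: is_derive_line; apply: diff_derivable; exact: df.
have [||c ch e] := @MVT R (fun r => f (x + r *: u)) (fun s => 'D_u f (x + s *: u))
    0 h h0.
- move=> s; rewrite in_itv /= => /andP[s0 sh]; apply: dl.
  by rewrite !ltW.
- apply: derivable_within_continuous => s; rewrite in_itv /= => sh.
  by have [] := dl s sh.
exists c; first by move: ch; rewrite in_itv.
by move: e; rewrite scale0r addr0 subr0.
Qed.

Variable D : set V.
Hypothesis oD : open D.

(** The mean value theorem is used twice: along [u] for the increment [g] of [f] by [h *: v], then
    along [v] for ['D_u f]. *)
Lemma second_difference (f : V -> R^o) x u v (h : R) : 0 < h ->
  smooth_on D f ->
  (forall s t, 0 <= s <= h -> 0 <= t <= h -> D (x + s *: u + t *: v)) ->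
  exists c d, [/\ 0 <= c <= h, 0 <= d <= h &
   f (x + h *: u + h *: v) - f (x + h *: u) - (f (x + h *: v) - f x) =
   'D_v ('D_u f) (x + c *: u + d *: v) * h * h].
Proof.
move=> h0 sf xD.
have hh : 0 <= h <= h by rewrite lexx ltW.
have zh : 0 <= (0 : R) <= h by rewrite lexx ltW.
pose g y : R^o := f (y + h *: v) - f y.
have dfs y w : D (y + w) -> differentiable (fun z => f (z + w)) y.
  move=> yD; apply: (differentiable_comp (f := fun z => z + w)).
    by apply: differentiableD; [exact: ex_diff|exact: differentiable_cst].
  exact: (smooth_differentiable sf).
have dg y : D y -> D (y + h *: v) -> differentiable g y.
  move=> yD yD'; apply: differentiableB; first exact: dfs.
  exact: (smooth_differentiable sf).
have gE y : D y -> D (y + h *: v) ->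
    'D_u g y = 'D_u f (y + h *: v) - 'D_u f y.
  move=> yD yD'; rewrite deriveB; last first.
  - exact/diff_derivable/(smooth_differentiable sf).
  - exact/diff_derivable/dfs.
  congr (_ - _); rewrite /derive.
  by under [in LHS]eq_fun do rewrite /= -addrA.
have xD0 s : 0 <= s <= h -> D (x + s *: u).
  by move=> sh; have := xD s 0 sh zh; rewrite scale0r addr0.
have [c /andP[c0 ch] gc] : exists2 c, 0 < c < h &
    g (x + h *: u) - g x = 'D_u g (x + c *: u) * h.
  by apply: (@MVT_line g x u h h0) => s sh; apply: dg; [exact: xD0|exact: xD].
have ch' : 0 <= c <= h by rewrite !ltW.
have [d /andP[d0 dh] fd] : exists2 d, 0 < d < h &
    'D_u f (x + c *: u + h *: v) - 'D_u f (x + c *: u) =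
    'D_v ('D_u f) (x + c *: u + d *: v) * h.
  apply: (@MVT_line ('D_u f) (x + c *: u) v h h0) => s sh.
  apply: (smooth_differentiable (D := D)); last exact: xD.
  exact: smooth_on_derive.
exists c, d; split => //; first by rewrite !ltW.
by rewrite -[LHS]/(g (x + h *: u) - g x) gc gE ?fd//; [exact: xD0|exact: xD].
Qed.

(** The second difference is symmetric in [u] and [v], so the two mixed derivatives take a common
    value at two points of a small parallelogram; their continuity at [x] then makes them equal
    there. *)
Lemma derive_comm (f : V -> R^o) x u v : smooth_on D f -> D x ->
  'D_u ('D_v f) x = 'D_v ('D_u f) x.
Proof.
move=> sf Dx.
apply/eqP; rewrite -subr_eq0 -normr_le0; apply/ler_addgt0Pl => e e0.
rewrite addr0.
have cD a b : {for x, continuous ('D_a ('D_b f))}.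
  apply: differentiable_continuous; apply: (smooth_differentiable (D := D)) => //.
  by do 2 apply: smooth_on_derive.
have e2 : 0 < e / 2 by rewrite divr_gt0.
have N1 : \forall y \near x, D y by exact: open_nbhs_nbhs.
have near_lt (g : V -> R^o) : {for x, continuous g} ->
    \forall y \near x, `|g x - g y| < e / 2.
  by move=> cg; have /cvgrPdist_lt/(_ _ e2) := cg.
have N23 := @filterI _ _ (nbhs_filter x) _ _ (near_lt _ (cD u v)) (near_lt _ (cD v u)).
have N123 := @filterI _ _ (nbhs_filter x) _ _ N1 N23.
have [r /= r0 rN] := (nbhs_normP _ _).1 N123.
(* Keeps the parallelogram of sides [h *: u], [h *: v] inside the ball of radius [r]; the summand 1
   makes the bound strict and covers [u = v = 0]. *)
pose h := r / (1 + `|u| + `|v|).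
have uv0 : 0 < 1 + `|u| + `|v| by rewrite -addrA ltr_pwDl ?addr_ge0.
have h0 : 0 < h by rewrite divr_gt0.
have near_x s t : 0 <= s <= h -> 0 <= t <= h -> ball_ Num.norm x r (x + s *: u + t *: v).
  move=> /andP[s0 sh] /andP[t0 th]; rewrite /ball_ /= -addrA opprD addrA subrr add0r.
  rewrite normrN (le_lt_trans (ler_normD _ _))// !normrZ !ger0_norm//.
  apply: (@le_lt_trans _ _ (h * (`|u| + `|v|))).
    by rewrite mulrDr lerD// ler_wpM2r.
  rewrite /h mulrAC ltr_pdivrMr// ltr_pM2l//.
  by rewrite -addrA ltrDr.
have [c [d [ch dh e1]]] := second_difference h0 sf
  (fun s t sh th => (rN _ (near_x s t sh th)).1).
have near_x' s t : 0 <= s <= h -> 0 <= t <= h -> ball_ Num.norm x r (x + s *: v + t *: u).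
  by move=> sh th; rewrite addrAC; exact: near_x.
have [c' [d' [ch' dh' e1']]] := second_difference h0 sf
  (fun s t sh th => (rN _ (near_x' s t sh th)).1).
have [_ [_ n1]] := rN _ (near_x c d ch dh).
have [_ [n2 _]] := rN _ (near_x' c' d' ch' dh').
have scal (d1 d2 a1 a2 a3 a4 : R) : a1 - a2 - (a3 - a4) = d1 * h * h ->
    a1 - a3 - (a2 - a4) = d2 * h * h -> d2 = d1.
  move=> E1 E2; have hn0 : h != 0 by rewrite gt_eqF.
  by apply: (mulIf hn0); apply: (mulIf hn0); rewrite -E1 -E2; ring.
have tri (a1 a2 a3 : R) : `|a1 - a3| < e / 2 -> `|a2 - a3| < e / 2 -> `|a1 - a2| <= e.
  move=> H1 H2; have -> : a1 - a2 = (a1 - a3) - (a2 - a3) by ring.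
  by rewrite (le_trans (ler_normB _ _))// (splitr e) lerD// ltW.
rewrite [x + h *: v + _]addrAC in e1'.
have E := scal _ _ _ _ _ _ e1 e1'.
rewrite E in n2.
exact: tri n2 n1.
Qed.

End Schwarz.

Section SchwarzMatrix.
Context {R : realType} {V : normedModType R}.

Lemma derive_comm_mx m n (D : set V) (f : V -> 'M[R]_(m, n)) x u v :
  open D -> smooth_on D f -> D x -> 'D_u ('D_v f) x = 'D_v ('D_u f) x.
Proof.
move=> oD sf Dx.
have E a b i j : ('D_a ('D_b f) x) i j = 'D_a ('D_b (fun y => f y i j : R^o)) x.
  rewrite -derive_entry; last first.
    exact: (smooth_differentiable (smooth_on_derive _ sf)).
  apply: near_eq_derive; apply: (near_open oD Dx) => y Dy.
  by rewrite derive_entry//; exact: (smooth_differentiable sf).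
apply/matrixP => i j.
have C := derive_comm oD u v (smooth_on_entry oD i j sf) Dx.
exact: (etrans (E u v i j) (etrans C (esym (E v u i j)))).
Qed.

End SchwarzMatrix.

(** * Pointwise algebra of the deformation *)

Section Deformation.
Context {R : realType} {m n : nat}.
Implicit Types (J : 'M[R]_n) (K : 'M[R]_(m, n)) (D : 'M[R]_(n, m)).

(** The entry is - dmu^j (J K_i) = omega (K_j, J K_i), because omega (K_j, .) = - dmu^j. In this
    form [w] does not occur, and the derivative involves only those of [J], [K], [D]. *)
Definition gram J K D : 'M[R]_m := - (K *m J *m D).

Definition resolvent (C G : 'M[R]_m) (t : R) : 'M[R]_m :=
  C *m invmx (1%:M + t *: (G *m C)).

(** Coefficients appear transposed because the sum of P_ij K_i (x) dmu^j is [D *m P^T *m K] on row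
    vectors. In the same convention [J *m D] is dmu o J and [K *m J] consists of the fields J
    K_i. *)
Definition deform (C : 'M[R]_m) (t : R) J K D : 'M[R]_n :=
  J + t *: (D *m C^T *m K)
    + t *: (J *m D *m (resolvent C (gram J K D) t)^T *m K *m J).

End Deformation.

Section Pointwise.
Context {R : realType} {m n : nat}.
Variables (w J : 'M[R]_n) (K : 'M[R]_(m, n)) (D : 'M[R]_(n, m)) (C : 'M[R]_m).
Hypotheses (wT : w^T = - w) (wU : w \in unitmx) (JJ : J *m J = - 1%:M).
Hypotheses (Jw : J *m w = - (w *m J^T)) (DE : D = w *m K^T) (KD : K *m D = 0).
Hypothesis tamed : forall v, v != 0 -> 0 < bilin w v (v *m J).
Hypothesis CT : C^T = - C.

Local Notation G := (gram J K D).
Local Notation B := (resolvent C G).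

Lemma gramE : G = K *m w *m J^T *m K^T.
Proof. by rewrite /gram DE mulmxA -(mulmxA K J w) Jw mulmxN mulNmx opprK !mulmxA. Qed.

Lemma KT_D : K *m w = - D^T.
Proof. by rewrite DE trmx_mul trmxK wT mulmxN ?opprK. Qed.

Lemma gram_sym : G^T = G.
Proof.
rewrite gramE !trmx_mul !trmxK wT mulNmx !mulmxN !mulmxA.
by rewrite -(mulmxA K J w) Jw mulmxN mulNmx opprK !mulmxA.
Qed.

Lemma quad_C (u : 'rV[R]_m) : u *m C *m u^T = 0.
Proof.
have E : (u *m C *m u^T)^T = - (u *m C *m u^T).
  by rewrite !trmx_mul trmxK CT mulNmx mulmxN mulmxA.
apply/matrixP => i j; rewrite !ord1 !mxE.
have := congr1 (fun M : 'M[R]_1 => M 0 0) E; rewrite !mxE; lra.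
Qed.

Lemma sandwich_C (u : 'rV[R]_m) (S : 'M[R]_m) : S^T = S ->
  u *m S *m C *m S *m u^T = 0.
Proof.
move=> ST; rewrite -(quad_C (u *m S)) trmx_mul ST.
by rewrite !mulmxA.
Qed.

(** For a row [v] in the kernel, v = - t v G C, so v G v^T = t v G C G v^T, which vanishes by
    antisymmetry of [C]. *)
Lemma unit_1GC t : 1%:M + t *: (G *m C) \in unitmx.
Proof.
rewrite -row_free_unit -kermx_eq0; apply/eqP/row_matrixP => i; rewrite row0.
set v := row i _.
have : v *m (1%:M + t *: (G *m C)) = 0.
  by rewrite /v -row_mul mulmx_ker row0.
rewrite mulmxDr mulmx1 -scalemxAr => /eqP; rewrite addr_eq0 => /eqP vE.
have vT : v^T = t *: (C *m G *m v^T).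
  rewrite [in LHS]vE linearN linearZ /= !trmx_mul gram_sym CT.
  by rewrite !mulNmx scalerN opprK.
have vGv : v *m G *m v^T = 0.
  by rewrite vT -scalemxAr !mulmxA sandwich_C ?scaler0// gram_sym.
(* v G v^T is the squared length of the vector [v *m K]. Its vanishing does not give [v = 0]
   directly, as the rows of [K] may be dependent, but [G] factors through [K], so v G = 0, and then
   v = - t v G C = 0. *)
have vK : v *m K = 0.
  apply/eqP; apply: contraT => /tamed.
  rewrite /bilin !trmx_mul !mulmxA.
  have := vGv; rewrite gramE !mulmxA => ->.
  by rewrite mxE ltxx.
have vG : v *m G = 0 by rewrite /gram mulmxN !mulmxA vK !mul0mx oppr0.
by rewrite vE mulmxA vG mul0mx scaler0 oppr0.
Qed.

Lemma unit_1CG t : 1%:M + t *: (C *m G) \in unitmx.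
Proof.
rewrite -unitmx_tr linearD /= trmx1 linearZ /= trmx_mul gram_sym CT mulmxN.
by rewrite scalerN -scaleNr unit_1GC.
Qed.

(** This equation, its right-handed version and their transposes characterize [B]. The algebraic
    proofs below generalize the inverse away and keep only such equations. *)
Lemma resolventl t : B t + t *: (B t *m G *m C) = C.
Proof.
rewrite -[X in X + _]mulmx1 -mulmxA scalemxAr -mulmxDr.
by rewrite mulmxKV ?unit_1GC.
Qed.

Lemma resolventr t : B t + t *: (C *m G *m B t) = C.
Proof.
rewrite -[X in X + _]mul1mx scalemxAl -mulmxDl /resolvent mulmxA.
rewrite mulmxDl mul1mx -scalemxAl -mulmxA.
rewrite -[X in X + _]mulmx1 [t *: _]scalemxAr -mulmxDr.
by rewrite mulmxK ?unit_1GC.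
Qed.

Lemma tr_resolventl t : (B t)^T - t *: (C *m G *m (B t)^T) = - C.
Proof.
move: gram_sym (resolventl t); move: (B t) => b; move: (G) => g gT /(congr1 trmx).
rewrite linearD linearZ /= !trmx_mul gT CT mulNmx scalerN mulmxA.
by move=> ->.
Qed.

Lemma tr_resolventr t : (B t)^T - t *: ((B t)^T *m G *m C) = - C.
Proof.
move: gram_sym (resolventr t); move: (B t) => b; move: (G) => g gT /(congr1 trmx).
rewrite linearD linearZ /= !trmx_mul gT CT !mulmxN scalerN mulmxA.
by move=> ->.
Qed.

(** Both sides solve the invertible linear system (1 - t C G) X = - C. This is why the adjoint of
    the structure at [t] involves the one at [- t]. *)
Lemma resolvent_tr t : (B t)^T = - B (- t).
Proof.
have U : 1%:M - t *: (C *m G) \in unitmx by rewrite -scaleNr unit_1CG.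
rewrite -(mulKmx U (B t)^T) -(mulKmx U (- B (- t))); congr (_ *m _).
rewrite !mulmxBl !mul1mx -!scalemxAl tr_resolventl.
by rewrite mulmxN scalerN -opprD -scaleNr resolventr.
Qed.

Lemma KJD : K *m J *m D = - G. Proof. by rewrite /gram opprK. Qed.

(** The source of the condition on the distribution: whatever [t], the deformed structure sends the
    fields K_i into the span of the J K_i. *)
Lemma K_deform t : K *m deform C t J K D = (1%:M - t *: (G *m (B t)^T)) *m (K *m J).
Proof.
rewrite /deform; move: KJD; move: (G) => g KJg.
rewrite !mulmxDr -!scalemxAr !mulmxA KD !mul0mx scaler0 addr0 KJg.
by rewrite !mulmxBl !mul1mx -!scalemxAl !mulNmx scalerN.
Qed.

(** Expand (J + tP + tQ)^2. Since [K *m D = 0], P and Q square to zero. The linear terms pair up as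
    PJ + JQ = D (- C - B') K J and JP + QJ = J D (- C - B') K; the two equations for B' turn these
    into - t PQ and - t QP, which cancel the quadratic terms. *)
Lemma deform_square t : deform C t J K D *m deform C t J K D = - 1%:M.
Proof.
rewrite /deform; move: KJD (tr_resolventl t) (tr_resolventr t).
move: (B t)^T => B'; move: (G) => g KJg rl rr.
pose P := D *m C^T *m K; pose Q := J *m D *m B' *m K *m J.
have E1 : - C - B' = t *: (- C *m g *m B').
  by rewrite !mulNmx scalerN -rl addrC addKr.
have E2 : - C - B' = t *: (B' *m g *m - C).
  by rewrite mulmxN scalerN -rr addrC addKr.
have PP : P *m P = 0 by rewrite /P !mulmxA -(mulmxA _ K D) KD mulmx0 !mul0mx.
have QQ : Q *m Q = 0.
  rewrite /Q !mulmxA -(mulmxA _ J J) JJ mulmxN mulmx1 !mulNmx.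
  by rewrite -(mulmxA _ K D) KD mulmx0 !mul0mx oppr0.
have PQ : P *m Q = - (D *m (- C *m g *m B') *m K *m J).
  rewrite /P /Q CT !mulmxA -(mulmxA (D *m - C) K J) -(mulmxA _ (K *m J) D) KJg.
  by rewrite [_ *m - g]mulmxN !mulNmx.
have QP : Q *m P = - (J *m D *m (B' *m g *m - C) *m K).
  rewrite /P /Q CT !mulmxA -(mulmxA (J *m D *m B') K J) -(mulmxA _ (K *m J) D) KJg.
  by rewrite [_ *m - g]mulmxN !mulNmx.
have JQ : J *m Q = - (D *m B' *m K *m J) by rewrite /Q !mulmxA JJ !mulNmx mul1mx.
have QJ : Q *m J = - (J *m D *m B' *m K).
  by rewrite /Q -(mulmxA _ J J) JJ mulmxN mulmx1.
have PJ : P *m J = D *m - C *m K *m J by rewrite /P CT.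
have JP : J *m P = J *m D *m - C *m K by rewrite /P CT !mulmxA.
rewrite /deform -/P -/Q !mulmxDl !mulmxDr -!scalemxAl -!scalemxAr.
rewrite JJ PP QQ PQ QP JQ QJ JP PJ !scaler0 !addr0.
have H1 : D *m - C *m K *m J - D *m B' *m K *m J =
    t *: (D *m (- C *m g *m B') *m K *m J).
  by rewrite -!mulmxBl -mulmxBr E1 -scalemxAr -!scalemxAl.
have H2 : J *m D *m - C *m K - J *m D *m B' *m K =
    t *: (J *m D *m (B' *m g *m - C) *m K).
  by rewrite -!mulmxBl -mulmxBr E2 -scalemxAr -!scalemxAl.
rewrite !scalerN -H1 -H2.
move: (D *m - C *m K *m J) (D *m B' *m K *m J) => X1 X2.
move: (J *m D *m - C *m K) (J *m D *m B' *m K) => Y1 Y2.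
by apply/matrixP => i j; rewrite !mxE; ring.
Qed.

(** Multiplication by [w] exchanges [K^T] with [D] and, up to sign, [D^T] with [K]. Each term thus
    keeps its shape while its coefficient is transposed, and transposing [C] or [B] amounts to a
    sign together with t -> - t. *)
Lemma deform_adj t :
  (invmx w *m deform C t J K D *m w)^T = - deform C (- t) J K D.
Proof.
suff E : deform C t J K D *m w = w *m (- deform C (- t) J K D)^T.
  by rewrite -mulmxA E mulKmx// trmxK.
rewrite /deform; move: (resolvent_tr t) (resolvent_tr (- t)); rewrite opprK.
move: (B t) (B (- t)) => b b' bE b'E.
have wK : w *m K^T = D by rewrite DE.
have Kw := KT_D.
have -> : (- (J + - t *: (D *m C^T *m K) + - t *: (J *m D *m b'^T *m K *m J)))^T
   = - J^T + t *: (K^T *m C *m D^T) + t *: (J^T *m K^T *m b' *m D^T *m J^T).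
  rewrite !scaleNr opprD opprD !opprK !linearD linearN !linearZ /=.
  by rewrite !trmx_mul !trmxK !mulmxA.
rewrite !mulmxDl !mulmxDr mulmxN -Jw -!scalemxAl -!scalemxAr.
rewrite !mulmxA; congr (_ + _ *: _ + _ *: _).
  by rewrite -mulmxA Kw CT wK !mulmxN mulNmx opprK.
rewrite -(mulmxA _ J w) Jw mulmxN mulmxA -(mulmxA _ K w) Kw.
have -> : w *m J^T = - (J *m w) by rewrite Jw opprK.
rewrite !mulNmx -(mulmxA J w) wK bE.
by rewrite !mulmxN !mulNmx !opprK.
Qed.

(* [w (v, J_t v)] turns out to be [g (v + t z, v + t z)] for the Kahler metric
   [g] and some [z] in the span of [K]. *)
Lemma deform_tamed t v : v != 0 -> 0 < bilin w v (v *m deform C t J K D).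
Proof.
move=> v0.
have [z vz E] : exists2 z, v + t *: z != 0 & v *m w *m (deform C t J K D)^T *m v^T =
    (v + t *: z) *m w *m J^T *m (v + t *: z)^T; last first.
  have := tamed vz; rewrite /bilin !trmx_mul !mulmxA.
  by rewrite -E.
rewrite /deform; move: gramE gram_sym (unit_1CG t) (resolventr t) KJD.
move: (B t) => b; move: (G) => g GE gT gU br KJg.
pose y := v *m J *m D.
pose u := y *m invmx (1%:M + t *: (C *m g)).
have yE : u + t *: (u *m C *m g) = y.
  rewrite -[X in X + _]mulmx1 -mulmxA scalemxAr -mulmxDr.
  by rewrite mulmxKV.
have yT : y^T = u^T - t *: (g *m C *m u^T).
  rewrite -yE linearD linearZ /= !trmx_mul gT CT mulNmx mulmxN scalerN.
  by rewrite !mulmxA.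
have yB : y *m b = u *m C.
  rewrite -yE mulmxDl -scalemxAl -!(mulmxA u) scalemxAr -mulmxDr.
  by rewrite br.
pose z := u *m C *m K.
have wK : w *m K^T = D by rewrite DE.
have vwJK : v *m w *m J^T *m K^T = - y.
  have wJ : w *m J^T = - (J *m w) by rewrite Jw opprK.
  by rewrite -(mulmxA v) wJ mulmxN mulNmx /y -wK !mulmxA.
have DJv : D^T *m J^T *m v^T = y^T by rewrite /y !trmx_mul mulmxA.
have zwJv : z *m w *m J^T *m v^T = - (u *m C *m y^T).
  by rewrite /z -(mulmxA _ K w) KT_D mulmxN !mulNmx -DJv !mulmxA.
have zwJz : z *m w *m J^T *m z^T = - (u *m C *m g *m C *m u^T).
  rewrite /z !trmx_mul CT GE !mulNmx !mulmxN; congr (- _).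
  by rewrite !mulmxA.
have vwJz : v *m w *m J^T *m z^T = y *m C *m u^T.
  rewrite /z !trmx_mul CT mulNmx !mulmxN.
  by rewrite !mulmxA vwJK !mulNmx opprK.
have X0 := quad_C u.
exists z.
  (* If v = - t z, then y = t u C G, while y = u + t u C G by the choice of [u]; hence u = 0, z = 0
     and v = 0. *)
  apply: contraNneq v0 => vz.
  have vE : v = - (t *: z) by apply/eqP; rewrite -addr_eq0 vz.
  have y_z : y = t *: (u *m C *m g).
    rewrite /y vE !mulNmx -!scalemxAl /z -(mulmxA _ K J) -(mulmxA _ (K *m J)) KJg.
    by rewrite mulmxN scalerN opprK.
  have u0 : u = 0 by apply: (addIr y); rewrite add0r {1}y_z yE.
  by rewrite vE /z u0 !mul0mx scaler0 oppr0.
have -> : (v + t *: z) *m w *m J^T *m (v + t *: z)^T =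
    v *m w *m J^T *m v^T + t *: (v *m w *m J^T *m z^T)
    + t *: (z *m w *m J^T *m v^T) + t *: (t *: (z *m w *m J^T *m z^T)).
  rewrite linearD linearZ /= !mulmxDl !mulmxDr -!scalemxAl -!scalemxAr.
  by rewrite -!addrA; congr (_ + _); rewrite addrCA !addrA.
have -> : v *m w *m (J + t *: (D *m C^T *m K) + t *: (J *m D *m b^T *m K *m J))^T
    *m v^T = v *m w *m J^T *m v^T + t *: (v *m D *m C *m (v *m D)^T)
      - t *: (y *m b *m y^T).
  have -> : (J + t *: (D *m C^T *m K) + t *: (J *m D *m b^T *m K *m J))^T
      = J^T + t *: (K^T *m C *m D^T) + t *: (J^T *m K^T *m b *m D^T *m J^T).
    by rewrite !linearD !linearZ /= !trmx_mul !trmxK !mulmxA.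
  rewrite -DJv !mulmxDr !mulmxDl -!scalemxAr -!scalemxAl !mulmxA vwJK.
  by rewrite -(mulmxA v w K^T) wK trmx_mul !mulmxA !mulNmx scalerN.
rewrite quad_C scaler0 addr0 zwJv zwJz vwJz yB yT -yE.
rewrite mulmxBr -scalemxAr !mulmxDl X0 -!scalemxAl !mulmxA.
move: (v *m w *m J^T *m v^T) (u *m C *m g *m C *m u^T) => Y X.
by apply/matrixP => i j; rewrite !mxE; ring.
Qed.

End Pointwise.

(** * The first-order jet of the deformation *)

Lemma addmxE {R : nmodType} m n (u v : 'M[R]_(m, n)) i j : (u + v) i j = u i j + v i j.
Proof. by rewrite mxE. Qed.

Lemma oppmxE {R : zmodType} m n (u : 'M[R]_(m, n)) i j : (- u) i j = - u i j.
Proof. by rewrite mxE. Qed.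

Lemma zeromxE {R : nmodType} m n i j : (0 : 'M[R]_(m, n)) i j = 0.
Proof. by rewrite mxE. Qed.

(* Linear arithmetic entry by entry, with matrix products as atoms and the matrix
   equations of the context as hypotheses. *)
Ltac entrywise :=
  let i := fresh "i" in let j := fresh "j" in
  apply/matrixP => i j;
  repeat match goal with
  | H : _ = _ |- _ =>
      apply (congr1 (fun M : matrix _ _ _ => M i j)) in H; revert H
  end;
  rewrite /= ?(addmxE, oppmxE, zeromxE); intros; lra.

(* Half of the Nijenhuis tensor at a point: the tensor is the antisymmetrization
   in [x], [y] of this expression in the value [J] and the derivative [dJ]. *)
Definition nijenhuis_jet (R : realFieldType) n (J : 'M[R]_n)
    (dJ : 'rV[R]_n -> 'M[R]_n) (x y : 'rV[R]_n) :=
  y *m dJ (x *m J) - y *m dJ x *m J.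

(* Values and derivatives at a point of [J], [K], [D = dmu], [L = J K],
   [E = dmu o J], [G = gram], [b = t B^T], with [S = t C^T]. The hypotheses
   [LieX_Y] say that [Y] is invariant under the flow of the fields [X], up to
   the derivative of [G] for [Y = D] or [Y = E] and [X = L]. *)
Section DeformedJet.
Context {R : realFieldType} {m n : nat}.
Variables (J : 'M[R]_n) (K L : 'M[R]_(m, n)) (D E : 'M[R]_(n, m)) (G S b : 'M[R]_m).
Variables (dJ : 'rV[R]_n -> 'M[R]_n) (dK dL : 'rV[R]_n -> 'M[R]_(m, n)).
Variables (dD dE : 'rV[R]_n -> 'M[R]_(n, m)) (dG db : 'rV[R]_n -> 'M[R]_m).
Implicit Types (x y u v : 'rV[R]_n) (c e : 'rV[R]_m).

Hypotheses (dJ_add : {morph dJ : u v / u + v}) (dK_add : {morph dK : u v / u + v}).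
Hypotheses (dL_add : {morph dL : u v / u + v}) (dD_add : {morph dD : u v / u + v}).
Hypotheses (dE_add : {morph dE : u v / u + v}) (dG_add : {morph dG : u v / u + v}).
Hypotheses (KJ : K *m J = L) (LJ : L *m J = - K).
Hypotheses (KD : K *m D = 0) (LD : L *m D = - G) (KE : K *m E = - G) (LE : L *m E = 0).
Hypothesis NJ : forall x y, nijenhuis_jet J dJ x y = nijenhuis_jet J dJ y x.
Hypothesis dD_sym : forall x y, y *m dD x = x *m dD y.
Hypothesis LieK_J : forall c x, x *m dJ (c *m K) = c *m dK (x *m J) - c *m dK x *m J.
Hypothesis LieL_J : forall c x, x *m dJ (c *m L) = c *m dL (x *m J) - c *m dL x *m J.
Hypothesis LieK_K : forall c e, c *m dK (e *m K) = e *m dK (c *m K).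
Hypothesis LieK_L : forall c e, c *m dK (e *m L) = e *m dL (c *m K).
Hypothesis LieL_L : forall c e, c *m dL (e *m L) = e *m dL (c *m L).
Hypothesis dG_sym : forall c e, c *m dG (e *m L) = e *m dG (c *m L).
Hypothesis dG_K : forall c e, e *m dG (c *m K) = 0.
Hypothesis LieK_D : forall c y, y *m dD (c *m K) = - (c *m dK y *m D).
Hypothesis LieL_D : forall c y, y *m dD (c *m L) = - (c *m dL y *m D) - c *m dG y.
Hypothesis LieK_E : forall c y, y *m dE (c *m K) = - (c *m dK y *m E).
Hypothesis LieL_E : forall c y, y *m dE (c *m L) = - (c *m dL y *m E) - c *m dG (y *m J).
Hypothesis dE_J_sym : forall x y,
  y *m dE (x *m J) - y *m dJ x *m E = x *m dE (y *m J) - x *m dJ y *m E.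
Hypothesis dD_J_sym : forall x y, y *m dD (x *m J) - y *m dJ x *m D + y *m dE x
  = x *m dD (y *m J) - x *m dJ y *m D + x *m dE y.
Hypothesis bS : b + b *m G *m S = S.
Hypothesis dbE : forall v, db v = - (b *m dG v *m b).
Variables (Jt : 'M[R]_n) (dJt : 'rV[R]_n -> 'M[R]_n).
Hypothesis JtE0 : Jt = J + D *m S *m K + E *m b *m L.
Hypothesis dJtE0 : forall v, dJt v = dJ v + (dD v *m S *m K + D *m S *m dK v)
  + (dE v *m b *m L + E *m db v *m L + E *m b *m dL v).

(** The jet is written as [N + kc *m K + lc *m L], and each of [N], [kc], [lc] is symmetric. For [N]
    this is integrability of [J] and the commutation of the fields [K], [L]; for [kc] closedness of
    dmu; for [lc] the symmetry of the derivatives of [G] and the identity [dE_J_sym]. *)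
Lemma nijenhuis_jet_deformed x y : nijenhuis_jet Jt dJt x y = nijenhuis_jet Jt dJt y x.
Proof.
(* Opaque names, so that products with [p z], [q z], [k z v], [l z v] remain atoms for [entrywise].
   They are the coefficients of [K] and [L] in [z *m Jt], respectively those created by
   differentiating the coefficients. *)
have [p pE] : exists p, forall z : 'rV[R]_n, p z = z *m D *m S by exists (fun z => z *m D *m S).
have [q qE] : exists q, forall z : 'rV[R]_n, q z = z *m E *m b by exists (fun z => z *m E *m b).
have [k kE] : exists k, forall z v : 'rV[R]_n, k z v = z *m dD v *m S.
  by exists (fun z v => z *m dD v *m S).
have [l lE] : exists l, forall z v : 'rV[R]_n, l z v = z *m dE v *m b - q z *m dG v *m b.
  by exists (fun z v => z *m dE v *m b - q z *m dG v *m b).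
have dJtE z v : z *m dJt v = z *m dJ v + p z *m dK v + q z *m dL v
    + k z v *m K + l z v *m L.
  rewrite dJtE0 dbE pE qE kE lE qE !mulmxDr mulmxBl mulmxN !mulNmx mulmxN !mulmxA.
  entrywise.
have JtE z : z *m Jt = z *m J + p z *m K + q z *m L.
  by rewrite JtE0 !mulmxDr pE qE !mulmxA.
have k_add z u v : k z (u + v) = k z u + k z v.
  by rewrite !kE dD_add mulmxDr mulmxDl.
have l_add z u v : l z (u + v) = l z u + l z v.
  rewrite !lE dE_add dG_add !mulmxDr !mulmxDl; entrywise.
pose N (x y : 'rV[R]_n) := y *m dJ (x *m J) - y *m dJ x *m J
  + (p x *m dK (y *m J) - p x *m dK y *m J + (p y *m dK (x *m J) - p y *m dK x *m J))
  + (q x *m dL (y *m J) - q x *m dL y *m J + (q y *m dL (x *m J) - q y *m dL x *m J))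
  + (p y *m dK (p x *m K) + p y *m dK (q x *m L)
     + q y *m dL (p x *m K) + q y *m dL (q x *m L)).
pose kc (x y : 'rV[R]_n) := k y (x *m J) + k y (p x *m K) + k y (q x *m L) + l y x
  - (y *m dJ x *m D + p y *m dK x *m D + q y *m dL x *m D - l y x *m G) *m S.
pose lc (x y : 'rV[R]_n) := l y (x *m J) + l y (p x *m K) + l y (q x *m L) - k y x
  - (y *m dJ x *m E + p y *m dK x *m E + q y *m dL x *m E - k y x *m G) *m b.
have decomp a1 a2 : nijenhuis_jet Jt dJt a1 a2 = N a1 a2 + kc a1 a2 *m K + lc a1 a2 *m L.
  rewrite /nijenhuis_jet (JtE a1) !dJtE JtE.
  set z := (a2 *m dJ a1 + _ + _ + _ + _).
  have zJ : z *m J = a2 *m dJ a1 *m J + p a2 *m dK a1 *m J + q a2 *m dL a1 *m J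
      + k a2 a1 *m L - l a2 a1 *m K.
    by rewrite /z !mulmxDl -(mulmxA (k a2 a1)) -(mulmxA (l a2 a1)) KJ LJ mulmxN.
  have zD : z *m D = a2 *m dJ a1 *m D + p a2 *m dK a1 *m D + q a2 *m dL a1 *m D
      - l a2 a1 *m G.
    by rewrite /z !mulmxDl -(mulmxA (k a2 a1)) -(mulmxA (l a2 a1)) KD LD mulmxN mulmx0 addr0.
  have zE : z *m E = a2 *m dJ a1 *m E + p a2 *m dK a1 *m E + q a2 *m dL a1 *m E
      - k a2 a1 *m G.
    by rewrite /z !mulmxDl -(mulmxA (k a2 a1)) -(mulmxA (l a2 a1)) KE LE mulmxN mulmx0 addr0.
  rewrite zJ (pE z) (qE z) zD zE /N /kc /lc.
  move: (_ - _ *m G) (_ - _ *m G) => zD' zE'.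
  rewrite !dJ_add !dK_add !dL_add !k_add !l_add !mulmxDr !mulmxDl !mulNmx.
  rewrite (LieK_J (p a1) a2) (LieL_J (q a1) a2).
  entrywise.
have N_sym a1 a2 : N a1 a2 = N a2 a1.
  have e1 := NJ a1 a2; have e2 := LieK_K (p a1) (p a2); have e3 := LieL_L (q a1) (q a2).
  have e4 := LieK_L (p a1) (q a2); have e5 := LieK_L (p a2) (q a1).
  rewrite /nijenhuis_jet in e1.
  rewrite /N; entrywise.
have kc_sym a1 a2 : kc a1 a2 = kc a2 a1.
  (* In [kc] the factor [l] occurs only through l (1 + G S). Since b (1 + G S) = S, the matrix [b]
     that ends [l] is replaced by [S], the matrix that ends the other terms. *)
  have lS z1 z2 : l z2 z1 + l z2 z1 *m G *m S = z2 *m dE z1 *m S - q z2 *m dG z1 *m S.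
    have -> : l z2 z1 = (z2 *m dE z1 - q z2 *m dG z1) *m b by rewrite lE mulmxBl.
    have := congr1 (mulmx (z2 *m dE z1 - q z2 *m dG z1)) bS.
    by rewrite mulmxDr !mulmxA => ->; rewrite mulmxBl.
  have e1 := congr1 (mulmx^~ S) (dD_J_sym a1 a2); rewrite !mulmxDl !mulNmx in e1.
  have e2 := lS a1 a2; have e3 := lS a2 a1.
  rewrite /kc !kE !LieK_D !LieL_D !mulmxDl !mulNmx.
  entrywise.
have lc_sym a1 a2 : lc a1 a2 = lc a2 a1.
  have e1 := congr1 (mulmx^~ b) (dE_J_sym a1 a2); rewrite !mulmxDl !mulNmx in e1.
  have e2 := congr1 (mulmx^~ b) (dG_sym (q a1) (q a2)).
  rewrite /lc !lE !kE !LieK_E !LieL_E !dG_K !mulmxDl !mulNmx (dD_sym a1 a2).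
  entrywise.
by rewrite !decomp N_sym kc_sym lc_sym.
Qed.

End DeformedJet.

(** * Commutation relations of K, J K, dmu and dmu o J from torus invariance and integrability *)

Section NijenhuisJet.
Context {R : realFieldType} {m n : nat}.
Variables (J : 'M[R]_n) (K : 'M[R]_(m, n)) (D : 'M[R]_(n, m)) (S b : 'M[R]_m).
Variables (dJ : 'rV[R]_n -> 'M[R]_n) (dK : 'rV[R]_n -> 'M[R]_(m, n)).
Variables (dD : 'rV[R]_n -> 'M[R]_(n, m)) (db : 'rV[R]_n -> 'M[R]_m).

Local Notation L := (K *m J).
Local Notation E := (J *m D).
Local Notation G := (- (K *m J *m D)).
Let dL v := dK v *m J + K *m dJ v.
Let dE v := dJ v *m D + J *m dD v.
Let dG v := - (dL v *m D + L *m dD v).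

Hypotheses (dJ_add : {morph dJ : u v / u + v}) (dK_add : {morph dK : u v / u + v}).
Hypotheses (dD_add : {morph dD : u v / u + v}).
Hypotheses (JJ : J *m J = - 1%:M) (KD : K *m D = 0).
Hypothesis dKD : forall v, dK v *m D + K *m dD v = 0.
Hypothesis dD_sym : forall x y, y *m dD x = x *m dD y.
Hypothesis LieK_J : forall c x, x *m dJ (c *m K) = c *m dK (x *m J) - c *m dK x *m J.
Hypothesis LieK_K : forall c e, c *m dK (e *m K) = e *m dK (c *m K).
Hypothesis NJ : forall x y, nijenhuis_jet J dJ x y = nijenhuis_jet J dJ y x.
Hypothesis bS : b + b *m G *m S = S.
Hypothesis dbE : forall v, db v = - (b *m dG v *m b).

(** The vanishing of the Nijenhuis tensor on K reads L_(JK) J = J o (L_K J), and L_K J = 0. *)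
Let LieL_J c x : x *m dJ (c *m L) = c *m dL (x *m J) - c *m dL x *m J.
Proof.
have := NJ (c *m K) x; rewrite /nijenhuis_jet => e1.
have := congr1 (mulmx^~ J) (LieK_J c x); rewrite mulmxBl -(mulmxA _ J J) JJ mulmxN mulmx1 => e2.
rewrite /dL !mulmxDr !mulmxDl !mulmxA in e1 *.
rewrite -(mulmxA _ J J) JJ mulmxN mulmx1.
entrywise.
Qed.

Let LieK_L c e : c *m dK (e *m L) = e *m dL (c *m K).
Proof.
have e1 := LieK_J c (e *m K); rewrite LieK_K in e1.
rewrite /dL mulmxDr !mulmxA in e1 *.
entrywise.
Qed.

Let dLE (c : 'rV_m) v : c *m dL v = c *m dK v *m J + c *m K *m dJ v.
Proof. by rewrite /dL mulmxDr !mulmxA. Qed.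

(** [JK, JK'] = J [JK, K'] = 0, because JK preserves J and commutes with K'. *)
Let LieL_L c e : c *m dL (e *m L) = e *m dL (c *m L).
Proof.
have e1 := LieL_J e (c *m K); have e2 := LieK_L c e.
have e3 := congr1 (mulmx^~ J) e2; rewrite -!(mulmxA _ K J) in e1.
rewrite [LHS]dLE; entrywise.
Qed.

Let dGE (c : 'rV_m) v : c *m dG v = - (c *m dL v *m D) - c *m L *m dD v.
Proof. by rewrite /dG mulmxN mulmxDr !mulmxA opprD. Qed.

(** As G_ij = - dmu^j (J K_i), this is closedness of dmu^j on the commuting fields J K_i and J
    K_k. *)
Let dG_sym (c e : 'rV_m) : c *m dG (e *m L) = e *m dG (c *m L).
Proof. by rewrite !dGE LieL_L dD_sym. Qed.

(** Closedness of dmu on the commuting fields K and JK, together with dmu (K) = 0. *)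
Let dG_K (c e : 'rV_m) : e *m dG (c *m K) = 0.
Proof.
rewrite dGE -LieK_L dD_sym.
have := congr1 (mulmx c) (dKD (e *m L)); rewrite mulmxDr mulmx0 (mulmxA c K) mulmxA => e1.
entrywise.
Qed.

Let LieK_D (c : 'rV_m) y : y *m dD (c *m K) = - (c *m dK y *m D).
Proof.
have := congr1 (mulmx c) (dKD y); rewrite mulmxDr mulmx0 !mulmxA dD_sym => e1.
entrywise.
Qed.

Let LieL_D (c : 'rV_m) y : y *m dD (c *m L) = - (c *m dL y *m D) - c *m dG y.
Proof.
rewrite dD_sym dGE; entrywise.
Qed.

Let LieK_E (c : 'rV_m) y : y *m dE (c *m K) = - (c *m dK y *m E).
Proof.
rewrite /dE mulmxDr !mulmxA LieK_J LieK_D mulmxBl.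
entrywise.
Qed.

Let LieL_E (c : 'rV_m) y : y *m dE (c *m L) = - (c *m dL y *m E) - c *m dG (y *m J).
Proof.
rewrite /dE mulmxDr (mulmxA y J) (mulmxA y) LieL_J LieL_D mulmxBl (mulmxA _ J D).
entrywise.
Qed.

(** The Nijenhuis identity paired with dmu; closedness of dmu at [(x *m J, y *m J)] absorbs the
    derivatives of [D]. *)
Let dE_J_sym x y : y *m dE (x *m J) - y *m dJ x *m E = x *m dE (y *m J) - x *m dJ y *m E.
Proof.
have := congr1 (mulmx^~ D) (NJ x y); rewrite /nijenhuis_jet !mulmxBl => e1.
have e2 := dD_sym (x *m J) (y *m J).
rewrite /dE !mulmxDr !mulmxA in e1 *.
entrywise.
Qed.

Let dD_J_sym x y : y *m dD (x *m J) - y *m dJ x *m D + y *m dE x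
  = x *m dD (y *m J) - x *m dJ y *m D + x *m dE y.
Proof.
have e1 := dD_sym (x *m J) y; have e2 := dD_sym x (y *m J).
rewrite /dE !mulmxDr !mulmxA; entrywise.
Qed.


Lemma nijenhuis_jet_deform x y :
  let Jt := J + D *m S *m K + E *m b *m L in
  let dJt v := dJ v + (dD v *m S *m K + D *m S *m dK v)
    + (dE v *m b *m L + E *m db v *m L + E *m b *m dL v) in
  nijenhuis_jet Jt dJt x y = nijenhuis_jet Jt dJt y x.
Proof.
have dL_add u v : dL (u + v) = dL u + dL v.
  by rewrite /dL dJ_add dK_add mulmxDl mulmxDr addrACA.
have dE_add u v : dE (u + v) = dE u + dE v.
  by rewrite /dE dJ_add dD_add mulmxDl mulmxDr addrACA.
have dG_add u v : dG (u + v) = dG u + dG v.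
  by rewrite /dG dL_add dD_add mulmxDl mulmxDr addrACA opprD.
have KE : K *m E = - G by rewrite mulmxA opprK.
have LD : L *m D = - G by rewrite opprK.
have LE : L *m E = 0.
  by rewrite mulmxA -(mulmxA K J J) JJ mulmxN mulmx1 mulNmx KD oppr0.
have LJ : L *m J = - K by rewrite -mulmxA JJ mulmxN mulmx1.
by move=> Jt dJt; apply: (@nijenhuis_jet_deformed _ _ _ J K L D E G S b dJ dK dL dD dE dG db).
Qed.

End NijenhuisJet.

(** * Charts *)

Section ChainRule.
Context {R : realType}.

Lemma derive_comp (U V W : normedModType R) (f : U -> V) (g : V -> W) x v :
  differentiable f x -> differentiable g (f x) ->
  'D_v (g \o f) x = 'D_('D_v f x) g (f x).
Proof.
move=> df dg; rewrite (deriveE _ df) (deriveE _ dg).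
by rewrite (deriveE _ (differentiable_comp df dg)) diff_comp.
Qed.

Lemma jacobian_comp m n p (f : 'rV[R]_m -> 'rV[R]_n) (g : 'rV[R]_n -> 'rV[R]_p) x :
  differentiable f x -> differentiable g (f x) ->
  jacobian (g \o f) x = jacobian f x *m jacobian g (f x).
Proof.
move=> df dg; apply/row_matrixP => i; rewrite !rowE mulmxA.
rewrite -(deriveEjacobian _ df) -(deriveEjacobian _ (differentiable_comp df dg)).
by rewrite -(deriveEjacobian _ dg) derive_comp.
Qed.

Lemma jacobian_near_eq m n (f g : 'rV[R]_m -> 'rV[R]_n) x :
  (\near x, f x = g x) -> differentiable f x -> jacobian f x = jacobian g x.
Proof.
move=> fg df; have dg := differentiable_near_eq fg df.
apply/row_matrixP => i.
exact: (etrans (rowE i (jacobian f x)) (etrans (esym (deriveEjacobian _ df))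
  (etrans (near_eq_derive _ fg) (etrans (deriveEjacobian _ dg)
    (esym (rowE i (jacobian g x))))))).
Qed.

Lemma jacobian_id n (x : 'rV[R]_n) : jacobian id x = 1%:M.
Proof.
have did : differentiable (id : 'rV[R]_n -> 'rV[R]_n) x by exact: ex_diff.
apply/row_matrixP => i.
rewrite (rowE i 1%:M) mulmx1 -[RHS](derive_id x) (deriveEjacobian _ did).
exact: rowE.
Qed.

Lemma derive_pairl (U V W : normedModType R) (F : U * V -> W) x y u :
  'D_u (fun z => F (z, y)) x = 'D_(u, 0) F (x, y).
Proof.
have E : (fun h : R => h^-1 *: (((fun z => F (z, y)) \o shift x) (h *: u) - F (x, y)))
    = (fun h : R => h^-1 *: ((F \o shift (x, y)) (h *: (u, 0)) - F (x, y))).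
  apply/funext => h /=.
  by rewrite -[h *: (u, 0) + (x, y)]/(h *: u + x, h *: 0 + y) scaler0 add0r.
by rewrite /derive E.
Qed.

Lemma derive_pairr (U V W : normedModType R) (F : U * V -> W) x y v :
  'D_v (fun z => F (x, z)) y = 'D_(0, v) F (x, y).
Proof.
have E : (fun h : R => h^-1 *: (((fun z => F (x, z)) \o shift y) (h *: v) - F (x, y)))
    = (fun h : R => h^-1 *: ((F \o shift (x, y)) (h *: (0, v)) - F (x, y))).
  apply/funext => h /=.
  by rewrite -[h *: (0, v) + (x, y)]/(h *: 0 + x, h *: v + y) scaler0 add0r.
by rewrite /derive E.
Qed.

(** Tensoriality: the derivatives of [X] and [Y] cancel because J J = - 1. Integrability can
    therefore be read off constant fields and checked at the level of jets. *)
Lemma nijenhuisE n (J : 'rV[R]_n -> 'M[R]_n) (X Y : 'rV[R]_n -> 'rV[R]_n) y :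
  differentiable J y -> differentiable X y -> differentiable Y y ->
  J y *m J y = - 1%:M ->
  nijenhuis J X Y y = nijenhuis_jet (J y) (fun v => 'D_v J y) (X y) (Y y)
    - nijenhuis_jet (J y) (fun v => 'D_v J y) (Y y) (X y).
Proof.
move=> dJ dX dY JJ; rewrite /nijenhuis /lie_bracket /nijenhuis_jet.
move: (derive_mulmx (X y *m J y) dY dJ) (derive_mulmx (Y y *m J y) dX dJ)
  (derive_mulmx (Y y) dX dJ) (derive_mulmx (X y) dY dJ).
move: (@derive R 'rV[R]_n 'rV[R]_n) (@derive R 'rV[R]_n 'M[R]_n) => d d' -> -> -> ->.
rewrite !mulmxBl !mulmxDl -!(mulmxA _ (J y) (J y)) JJ !mulmxN !mulmx1.
entrywise.
Qed.

End ChainRule.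

Section Charts.
Context {R : realType} {n : nat} {M : topologicalType} (A : @atlas R n M).
Local Notation cdm p := (cdom (chart_at A p)).
Local Notation phi p := (cmap (chart_at A p)).
Local Notation psi p := (cinv (chart_at A p)).

Lemma in_chart_setT q x : cdm q x -> in_chart A q setT (phi q x).
Proof. by move=> qx; exists x. Qed.

Lemma cinv_cdom q y : in_chart A q setT y -> cdm q (psi q y).
Proof. by move=> [x [qx _] <-]; rewrite cmapK. Qed.

Lemma cinvK q y : in_chart A q setT y -> phi q (psi q y) = y.
Proof. by move=> [x [qx _] <-]; rewrite cmapK. Qed.

Lemma open_in_chart q : open (in_chart A q setT).
Proof. by rewrite /in_chart setIT; exact: cimg_open. Qed.

Lemma cinv_cvg q y : in_chart A q setT y -> {for y, continuous (psi q)}.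
Proof.
move=> qy.
have := @cinv_continuous _ _ _ (chart_at A q).
rewrite continuous_open_subspace; last exact: cimg_open.
by apply; rewrite inE; move: qy; rewrite /in_chart setIT.
Qed.

Lemma near_cinv q x (P : M -> Prop) : cdm q x -> (\forall z \near x, P z) ->
  \forall y \near phi q x, P (psi q y).
Proof.
move=> qx Px; apply: (cinv_cvg (in_chart_setT qx)).
by rewrite cmapK.
Qed.

Lemma near_cdom q x : cdm q x -> \forall z \near x, cdm q z.
Proof. by move=> qx; apply: open_nbhs_nbhs; split=> //; exact: cdom_open. Qed.

Lemma transition_differentiable p q x : cdm p x -> cdm q x ->
  differentiable (phi q \o psi p) (phi p x).
Proof.
move=> px qx; apply: (smooth_differentiable (@chart_compat _ _ _ A p q)).
by exists x.
Qed.

Lemma derive_cmap (V : normedModType R) (c : V -> M) z p q v :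
  {for z, continuous c} -> cdm p (c z) -> cdm q (c z) ->
  differentiable (phi p \o c) z ->
  differentiable (phi q \o c) z /\
  'D_v (phi q \o c) z = 'D_v (phi p \o c) z *m transition A p q (c z).
Proof.
move=> cc px qx dc.
have E : \forall z' \near z, ((phi q \o psi p) \o (phi p \o c)) z' = (phi q \o c) z'.
  have N : \forall z' \near z, cdm p (c z') := cc _ (near_cdom px).
  by apply: (filterS _ N) => z' cz'; rewrite /= cmapK.
have dt := transition_differentiable px qx.
have dd : differentiable ((phi q \o psi p) \o (phi p \o c)) z.
  apply: differentiable_comp => //.
split; first exact: differentiable_near_eq E dd.
rewrite -(near_eq_derive _ E) (derive_comp _ dc dt).
by rewrite (deriveEjacobian _ dt).
Qed.

Lemma jacobian_cinv k (f : M -> 'rV[R]_k) p q x : cdm p x -> cdm q x ->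
  differentiable (f \o psi p) (phi p x) ->
  differentiable (f \o psi q) (phi q x) /\
  jacobian (f \o psi q) (phi q x) = transition A q p x *m jacobian (f \o psi p) (phi p x).
Proof.
move=> px qx df.
have E : \forall y \near phi q x, ((f \o psi p) \o (phi p \o psi q)) y = (f \o psi q) y.
  by apply: (filterS _ (near_cinv qx (near_cdom px))) => y py; rewrite /= cmapK.
have dt := transition_differentiable qx px.
have xE : (phi p \o psi q) (phi q x) = phi p x by rewrite /= cmapK.
have df' : differentiable (f \o psi p) ((phi p \o psi q) (phi q x)) by rewrite xE.
have dd := differentiable_comp dt df'.
split; first exact: differentiable_near_eq E dd.
have J := jacobian_comp dt df'; rewrite xE in J.
exact: (etrans (esym (jacobian_near_eq E dd)) J).
Qed.

Lemma transition_id p x : cdm p x -> transition A p p x = 1%:M.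
Proof.
move=> px; rewrite -(jacobian_id (phi p x)).
have N : \forall y \near phi p x, (phi p \o psi p) y = id y.
  by apply: (near_open (@open_in_chart p) (in_chart_setT px)) => y py; rewrite /= cinvK.
exact: jacobian_near_eq N (transition_differentiable px px).
Qed.

Lemma transitionM p q r x : cdm p x -> cdm q x -> cdm r x ->
  transition A p q x *m transition A q r x = transition A p r x.
Proof.
move=> px qx rx.
have [_ J] := jacobian_cinv qx px (transition_differentiable qx rx).
exact: esym J.
Qed.

Lemma transitionK p q x : cdm p x -> cdm q x ->
  transition A p q x *m transition A q p x = 1%:M.
Proof. by move=> px qx; rewrite transitionM// transition_id. Qed.

End Charts.

(** * The torus action in charts *)

Lemma jacobian_cmap {R : realType} {n k : nat} {M : topologicalType} (A : @atlas R n M)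
    (c : 'rV[R]_k -> M) z p q :
  {for z, continuous c} -> cdom (chart_at A p) (c z) -> cdom (chart_at A q) (c z) ->
  differentiable (cmap (chart_at A p) \o c) z ->
  differentiable (cmap (chart_at A q) \o c) z /\
  jacobian (cmap (chart_at A q) \o c) z =
  jacobian (cmap (chart_at A p) \o c) z *m transition A p q (c z).
Proof.
move=> cc px qx dc; have [dq _] := derive_cmap 0 cc px qx dc; split=> //.
apply/row_matrixP => i.
have [_ E] := derive_cmap (delta_mx 0 i) cc px qx dc.
rewrite row_mul.
exact: (etrans (rowE _ _) (etrans (esym (deriveEjacobian _ dq))
  (etrans E (congr1 (mulmx^~ _) (etrans (deriveEjacobian _ dc) (esym (rowE _ _))))))).
Qed.

Section TorusAction.
Context {R : realType} {m : nat} {M : topologicalType} (T : toric_manifold R m M).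
Local Notation A := (tm_atlas T).
Local Notation act := (tm_act T).
Local Notation mu := (tm_mu T).
Local Notation w := (tm_omega T).
Local Notation cdm p := (cdom (chart_at A p)).
Local Notation phi p := (cmap (chart_at A p)).
Local Notation psi p := (cinv (chart_at A p)).
Local Notation D := (differential A mu).

Lemma act_cvg theta x : {for x, continuous (act theta)}.
Proof.
exact: (@continuous2_cvg _ _ _ _ (nbhs x) _ (fun=> theta) id act theta x
  (@act_continuous _ _ _ _ _ _ _ (tm_action T) (theta, x))
  (@cvg_cst _ theta _ (nbhs x) _) cvg_id).
Qed.

Lemma act_orbit_cvg theta x : {for theta, continuous (act^~ x)}.
Proof.
exact: (@continuous2_cvg _ _ _ _ (nbhs theta) _ id (fun=> x) act theta x
  (@act_continuous _ _ _ _ _ _ _ (tm_action T) (theta, x))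
  cvg_id (@cvg_cst _ x _ (nbhs theta) _)).
Qed.

Definition act_chart q r (z : 'rV[R]_m * 'rV[R]_(m + m)) : 'rV[R]_(m + m) :=
  phi r (act z.1 (psi q z.2)).

Definition act_dom q r : set ('rV[R]_m * 'rV[R]_(m + m)) :=
  [set z | in_chart A q setT z.2 /\ cdm r (act z.1 (psi q z.2))].

Lemma act_chart_smooth q r : smooth_on (act_dom q r) (act_chart q r).
Proof. exact: (act_smooth (tm_action T)). Qed.

Lemma open_act_dom q r : open (act_dom q r).
Proof.
rewrite openE => -[theta y] /= [qy ry].
have N1 : \forall z \near (theta, y), in_chart A q setT z.2.
  have N : \forall y' \near y, in_chart A q setT y'.
    by apply: open_nbhs_nbhs; split=> //; exact: open_in_chart.
  exact: (cvg_snd N).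
have C := @continuous2_cvg _ _ _ _ (nbhs (theta, y)) _ fst (psi q \o snd) act _ _
  (@act_continuous _ _ _ _ _ _ _ (tm_action T) (theta, psi q y))
  (@cvg_fst _ _ (nbhs theta) (nbhs y) _)
  (cvg_comp snd (psi q) (@cvg_snd _ _ (nbhs theta) (nbhs y) _) (cinv_cvg qy)).
have N2 := C (nbhs_filter _) (nbhs_filter _) (nbhs_filter _) _ (near_cdom ry).
have N3 := @filterI _ _ (nbhs_filter (theta, y)) _ _ N1 N2.
apply: (@filterS _ _ (nbhs_filter (theta, y)) _ _ _ N3).
by move=> z [z1 z2]; split.
Qed.

Lemma act_chart_differentiable q r z : act_dom q r z -> differentiable (act_chart q r) z.
Proof. exact: (smooth_differentiable (@act_chart_smooth q r)). Qed.

Lemma act_dom_pt q r theta x : cdm q x -> cdm r (act theta x) ->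
  act_dom q r (theta, phi q x).
Proof. by move=> qx rx; split=> /=; [exact: in_chart_setT|rewrite cmapK]. Qed.

Lemma orbit_differentiable r theta x : cdm r (act theta x) ->
  differentiable (phi r \o act^~ x) theta.
Proof.
move=> rx; have dF := act_chart_differentiable (act_dom_pt (chart_at_mem A x) rx).
have E : phi r \o act^~ x = act_chart x r \o (fun theta => (theta, phi x x)).
  by apply/funext => z; rewrite /act_chart /= cmapK//; exact: chart_at_mem.
rewrite E; apply: differentiable_comp dF.
by apply: differentiable_pair; [exact: ex_diff|exact: differentiable_cst].
Qed.

Lemma act_differentiable q r theta x : cdm q x -> cdm r (act theta x) ->
  differentiable (phi r \o act theta \o psi q) (phi q x).
Proof.
move=> qx rx; have dF := act_chart_differentiable (act_dom_pt qx rx).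
have E : phi r \o act theta \o psi q = act_chart q r \o (fun y => (theta, y)) by [].
rewrite E; apply: differentiable_comp dF.
by apply: differentiable_pair; [exact: differentiable_cst|exact: ex_diff].
Qed.

Lemma mu_differentiable q x : cdm q x -> differentiable (mu \o psi q) (phi q x).
Proof.
move=> qx; apply: (smooth_differentiable (@mm_smooth _ _ _ _ _ _ _ _ (tm_moment T) q)).
exact: in_chart_setT.
Qed.

Lemma act0x x : act 0 x = x. Proof. exact: (act0 (tm_action T)). Qed.

(** Replaces m one-variable derivatives by the Jacobian of the orbit map, to which the chain rule
    and changes of chart apply at once. *)
Lemma K_span_jacobian x : K_span T x = jacobian (phi x \o act^~ x) 0.
Proof.
have d0 : differentiable (phi x \o act^~ x) 0.
  by apply: orbit_differentiable; rewrite act0x; exact: chart_at_mem.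
apply/row_matrixP => j; rewrite rowK.
apply: (etrans _ (etrans (deriveEjacobian (delta_mx 0 j) d0) (esym (rowE _ _)))).
rewrite /K /induced_field derive1E.
have d1 : derivable (phi x \o act^~ x) (0 + (0 : R) *: delta_mx 0 j) (delta_mx 0 j).
  by rewrite scale0r addr0; exact: diff_derivable.
have [_] := is_derive_line d1.
rewrite scale0r addr0 => <-.
have E : (fun s : R => phi x (act (s *: delta_mx 0 j) x)) =
    (fun r : R => (phi x \o act^~ x) (0 + r *: delta_mx 0 j)).
  by apply/funext => s; rewrite /= add0r.
exact: (congr1 (fun f => derive f (0 : R) 1) E).
Qed.

Lemma K_span_chart q x : cdm q x ->
  K_span T x *m transition A x q x = jacobian (phi q \o act^~ x) 0.
Proof.
move=> qx.
have x0 : cdm x (act 0 x) by rewrite act0x; exact: chart_at_mem.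
have q0 : cdm q (act 0 x) by rewrite act0x.
have [_ J] := jacobian_cmap (@act_orbit_cvg 0 x) x0 q0 (orbit_differentiable x0).
rewrite act0x in J; rewrite K_span_jacobian; exact: esym J.
Qed.

(** The moment map is constant along each orbit. *)
Lemma K_span_D x : K_span T x *m D x = 0.
Proof.
have xx := chart_at_mem A x.
have x0 : cdm x (act 0 x) by rewrite act0x.
have d0 := orbit_differentiable x0.
have dm : differentiable (mu \o psi x) ((phi x \o act^~ x) 0).
  by rewrite /= act0x; exact: mu_differentiable.
have E0 : (phi x \o act^~ x) 0 = phi x x by rewrite /= act0x.
have J := etrans (jacobian_comp d0 dm)
  (congr1 (fun z => _ *m jacobian (mu \o psi x) z) E0).
rewrite K_span_jacobian; apply: (etrans (esym J)).
have N : \forall theta \near (0 : 'rV[R]_m),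
    cst (mu x) theta = ((mu \o psi x) \o (phi x \o act^~ x)) theta.
  have N' : \forall theta \near (0 : 'rV[R]_m), cdm x (act theta x).
    by apply: (@act_orbit_cvg 0 x); rewrite act0x; exact: near_cdom.
  apply: (filterS _ N') => theta tx.
  by rewrite /= cmapK// (mm_invariant (tm_moment T)).
apply: (etrans (esym (jacobian_near_eq N (differentiable_cst _ _)))).
apply/row_matrixP => i; rewrite row0.
apply: (etrans (rowE _ _)).
apply: (etrans (esym (deriveEjacobian _ (differentiable_cst _ _)))).
exact: derive_cst.
Qed.

(** Commutativity of the torus: the identity act theta (act eta x) = act eta (act theta x) is
    differentiated at eta = 0. *)
Lemma K_span_equivariant theta x :
  K_span T x *m tangent_map A (act theta) x = K_span T (act theta x).
Proof.
set x' := act theta x.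
have xx := chart_at_mem A x; have xx' := chart_at_mem A x'.
have x0 : cdm x (act 0 x) by rewrite act0x.
have d0 := orbit_differentiable x0.
have dt : differentiable (phi x' \o act theta \o psi x) ((phi x \o act^~ x) 0).
  by rewrite /= act0x; exact: act_differentiable.
have E0 : (phi x \o act^~ x) 0 = phi x x by rewrite /= act0x.
have J := etrans (jacobian_comp d0 dt)
  (congr1 (fun z => _ *m jacobian (phi x' \o act theta \o psi x) z) E0).
rewrite !K_span_jacobian; apply: (etrans (esym J)).
apply: jacobian_near_eq; last exact: differentiable_comp.
have N' : \forall eta \near (0 : 'rV[R]_m), cdm x (act eta x).
  by apply: (@act_orbit_cvg 0 x); rewrite act0x; exact: near_cdom.
apply: (filterS _ N') => eta ex.
rewrite /= cmapK//; congr (phi x' _).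
by rewrite -!(actD (tm_action T)) addrC.
Qed.

Lemma D_equivariant theta x : tangent_map A (act theta) x *m D (act theta x) = D x.
Proof.
set x' := act theta x.
have xx := chart_at_mem A x; have xx' := chart_at_mem A x'.
have dt := @act_differentiable x x' theta x xx xx'.
have dm : differentiable (mu \o psi x') ((phi x' \o act theta \o psi x) (phi x x)).
  by rewrite /= cmapK//; exact: mu_differentiable.
have E0 : (phi x' \o act theta \o psi x) (phi x x) = phi x' x' by rewrite /= cmapK.
have J := etrans (jacobian_comp dt dm)
  (congr1 (fun z => _ *m jacobian (mu \o psi x') z) E0).
apply: (etrans (esym J)).
apply: jacobian_near_eq; last exact: differentiable_comp.
have N' : \forall y \near phi x x, cdm x' (act theta (psi x y)).
  have N0 : \forall z \near x, cdm x' (act theta z).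
    by apply: (@act_cvg theta x); exact: near_cdom.
  exact: (near_cinv xx N0).
apply: (filterS _ N') => y yx.
by rewrite /= cmapK// (mm_invariant (tm_moment T)).
Qed.

Lemma tangent_chart theta q x : cdm q x -> cdm q (act theta x) ->
  jacobian (phi q \o act theta \o psi q) (phi q x) =
  transition A q x x *m tangent_map A (act theta) x
    *m transition A (act theta x) q (act theta x).
Proof.
set x' := act theta x => qx qx'.
have xx := chart_at_mem A x; have xx' := chart_at_mem A x'.
have [_ J1] := jacobian_cinv xx qx (f := phi q \o act theta) (act_differentiable xx qx').
apply: (etrans J1); rewrite -mulmxA; congr (_ *m _).
have c0 : {for phi x x, continuous (act theta \o psi x)}.
  apply: (@continuous_comp _ _ _ (psi x) (act theta)).
    exact: (cinv_cvg (in_chart_setT xx)).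
  exact: act_cvg.
have E : (act theta \o psi x) (phi x x) = x' by rewrite /= cmapK.
have x1 : cdm x' ((act theta \o psi x) (phi x x)) by rewrite E.
have q1 : cdm q ((act theta \o psi x) (phi x x)) by rewrite E.
have [_ J] := jacobian_cmap c0 x1 q1 (act_differentiable xx xx').
by rewrite E in J.
Qed.

End TorusAction.

Section ToricChart.
Context {R : realType} {m : nat} {M : topologicalType} (T : toric_manifold R m M).
Variable q : M.
Local Notation A := (tm_atlas T).
Local Notation act := (tm_act T).
Local Notation mu := (tm_mu T).
Local Notation w := (tm_omega T).
Local Notation cdm p := (cdom (chart_at A p)).
Local Notation phi p := (cmap (chart_at A p)).
Local Notation psi p := (cinv (chart_at A p)).
Local Notation O := (in_chart A q [set: M]).
Local Notation D := (differential A mu).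
Local Notation tr p r x := (transition A p r x).

Definition D_chart (y : 'rV[R]_(m + m)) : 'M[R]_(m + m, m) :=
  jacobian (mu \o psi q) y.

Definition K_chart (y : 'rV[R]_(m + m)) : 'M[R]_(m, m + m) :=
  K_span T (psi q y) *m tr (psi q y) q (psi q y).

Lemma omega_K_span x : D x = w x *m (K_span T x)^T.
Proof.
have wT := symp_alt (tm_symplectic T) x.
suff E : K_span T x *m w x = - (D x)^T.
  have := congr1 trmx E; rewrite trmx_mul wT linearN /= trmxK mulNmx => /eqP.
  by rewrite eqr_opp => /eqP.
apply/matrixP => j k.
have H := mm_hamiltonian (tm_moment T) j x (delta_mx 0 k).
transitivity (bilin (w x) (K T j x) (delta_mx 0 k)).
  rewrite /bilin trmx_delta -colE [RHS]mxE.
  transitivity (row j (K_span T x *m w x) 0 k); first by rewrite [RHS]mxE.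
  by rewrite row_mul rowK.
apply: (etrans H); rewrite /coord_covector -rowE.
by rewrite mxE [in RHS]mxE [in RHS]mxE mxE.
Qed.

Lemma D_chartE y : O y -> D_chart y = tr q (psi q y) (psi q y) *m D (psi q y).
Proof.
move=> Oy; have qx := cinv_cdom Oy; have xx := chart_at_mem A (psi q y).
have [_] := jacobian_cinv xx qx (mu_differentiable xx).
by rewrite cinvK.
Qed.

Lemma omega_K_chart y : O y -> form_in_chart A w q y *m (K_chart y)^T = D_chart y.
Proof.
move=> Oy; have qx := cinv_cdom Oy; have xx := chart_at_mem A (psi q y).
rewrite (D_chartE Oy) omega_K_span /form_in_chart /K_chart; move: (transitionK xx qx).
move: (tr q _ _) (tr _ q _) (w _) (K_span T _) => a b w0 k ba.
by rewrite trmx_mul !mulmxA -(mulmxA _ a^T) -trmx_mul ba trmx1 mulmx1.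
Qed.

Lemma unit_form_chart y : O y -> form_in_chart A w q y \in unitmx.
Proof.
move=> Oy; have qx := cinv_cdom Oy; have xx := chart_at_mem A (psi q y).
have [U _] := mulmx1_unit (transitionK qx xx).
by rewrite /form_in_chart !unitmx_mul unitmx_tr U (symp_nondeg (tm_symplectic T)).
Qed.

Lemma smooth_D_chart : smooth_on O D_chart.
Proof.
have oO := @open_in_chart _ _ _ A q.
have smu : smooth_on O (mu \o psi q).
  exact: (@mm_smooth _ _ _ _ _ _ _ _ (tm_moment T) q).
apply: (smooth_on_mx oO) => i j.
have sd := smooth_on_entry oO 0 j (smooth_on_derive (delta_mx 0 i) smu).
apply: (smooth_on_eq oO _ sd) => y Oy.
have dmu := smooth_differentiable smu Oy.
have E := deriveEjacobian (delta_mx 0 i) dmu.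
by rewrite E -rowE mxE.
Qed.

(** [K_chart] is assembled point by point from varying charts, so its smoothness is not visible from
    the definition. It is recovered from the moment map equation, as the transpose of omega^-1
    dmu. *)
Lemma smooth_K_chart : smooth_on O K_chart.
Proof.
have oO := @open_in_chart _ _ _ A q.
have sw := @symp_smooth _ _ _ _ _ (tm_symplectic T) q.
have s := smooth_on_trmx oO (smooth_on_mulmx oO
  (smooth_on_invmx oO sw unit_form_chart) smooth_D_chart).
apply: (smooth_on_eq oO _ s) => y Oy.
by rewrite -(omega_K_chart Oy) (mulKmx (unit_form_chart Oy)) trmxK.
Qed.

Lemma K_chart_D y : O y -> K_chart y *m D_chart y = 0.
Proof.
move=> Oy; have qx := cinv_cdom Oy; have xx := chart_at_mem A (psi q y).
rewrite (D_chartE Oy) /K_chart; move: (transitionK xx qx) (K_span_D T (psi q y)).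
move: (tr q _ _) (tr _ q _) (D _) (K_span T _) => a b d k ba kd.
by rewrite mulmxA -(mulmxA k) ba mulmx1.
Qed.

Lemma K_chart_act theta y : O y -> cdm q (act theta (psi q y)) ->
  K_chart y *m jacobian (phi q \o act theta \o psi q) y =
  K_chart (phi q (act theta (psi q y))).
Proof.
move=> Oy qx'; have qx := cinv_cdom Oy; have xx := chart_at_mem A (psi q y).
have J := tangent_chart qx qx'; rewrite (cinvK Oy) in J.
apply: (etrans (congr1 (mulmx _) J)).
rewrite /K_chart (cmapK qx') -K_span_equivariant; move: (transitionK xx qx).
move: (tr (psi q y) q _) (tr q (psi q y) _) (tr (act theta (psi q y)) q _) => b a c ba.
by rewrite !mulmxA -(mulmxA _ b) ba mulmx1.
Qed.

Lemma endo_chart_act (J : M -> 'M[R]_(m + m)) theta y :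
  (forall theta p, J p *m tangent_map A (act theta) p
     = tangent_map A (act theta) p *m J (act theta p)) ->
  O y -> cdm q (act theta (psi q y)) ->
  endo_in_chart A J q y *m jacobian (phi q \o act theta \o psi q) y =
  jacobian (phi q \o act theta \o psi q) y
    *m endo_in_chart A J q (phi q (act theta (psi q y))).
Proof.
move=> Jinv Oy qx'; have qx := cinv_cdom Oy; have xx := chart_at_mem A (psi q y).
set x' := act theta (psi q y) in qx' *; have xx' := chart_at_mem A x'.
have J1 := tangent_chart qx qx'; rewrite (cinvK Oy) in J1.
apply: (etrans (congr1 (mulmx _) J1)).
apply: (etrans _ (esym (congr1 (mulmx^~ _) J1))).
rewrite /endo_in_chart /= !(cmapK qx'); move: (Jinv theta (psi q y)).
move: (transitionK xx qx) (transitionK xx' qx'); rewrite -/x'.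
move: (tr (psi q y) q _) (tr q (psi q y) _) (tr x' q _) (tr q x' _).
move: (J (psi q y)) (J x') (tangent_map A _ _) => j j' t a b c d ab cd jt.
by rewrite !mulmxA -(mulmxA _ a) ab mulmx1 -(mulmxA _ c) cd mulmx1 -(mulmxA b) jt !mulmxA.
Qed.

Local Notation F := (act_chart T q q).

Lemma act_dom0 y : O y -> act_dom T q q (0, y).
Proof. by move=> Oy; split=> //=; rewrite act0x; exact: cinv_cdom. Qed.

Lemma derive_act_chart y c : O y -> 'D_(c, 0) F (0, y) = c *m K_chart y.
Proof.
move=> Oy; have qx := cinv_cdom Oy.
have q0 : cdm q (act 0 (psi q y)) by rewrite act0x.
rewrite /K_chart K_span_chart//.
apply: (etrans (esym (derive_pairl F 0 y c))).
exact: (deriveEjacobian _ (orbit_differentiable q0)).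
Qed.

Lemma derive_act_chart0 y v : O y -> 'D_(0, v) F (0, y) = v.
Proof.
move=> Oy; apply: (etrans (esym (derive_pairr F 0 y v))).
have N : \forall z \near y, F (0, z) = id z.
  apply: (near_open (@open_in_chart _ _ _ A q) Oy) => z Oz.
  by rewrite /act_chart /= act0x cinvK.
exact: (etrans (near_eq_derive v N) (derive_id _ _)).
Qed.

Lemma derive_act_chart_dir y v theta : act_dom T q q (theta, y) ->
  'D_(0, v) F (theta, y) = v *m jacobian (phi q \o act theta \o psi q) y.
Proof.
move=> [/= Oy qx']; have qx := cinv_cdom Oy.
apply: (etrans (esym (derive_pairr F theta y v))).
have d := act_differentiable qx qx'; rewrite (cinvK Oy) in d.
exact: deriveEjacobian.
Qed.

(* Mixed partial derivatives of the action at the identity: the derivative of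
   the linearized flow of a fundamental field is the derivative of the field. *)
Lemma derive_flow y c v : O y ->
  is_derive (0 : R) 1 (fun s : R => 'D_(0, v) F (s *: c, y)) (c *m 'D_v K_chart y).
Proof.
move=> Oy; have oO := @open_in_chart _ _ _ A q.
have D0 := act_dom0 Oy.
have oD := @open_act_dom R m M T q q.
have sF := @act_chart_smooth R m M T q q.
have g0 : (0, y) + (0 : R) *: (c, 0) = (0, y) :> 'rV[R]_m * 'rV[R]_(m + m).
  by rewrite scale0r addr0.
have d1 : derivable ('D_(0, v) F) ((0, y) + (0 : R) *: (c, 0)) (c, 0).
  rewrite g0; apply: diff_derivable.
  exact: (smooth_differentiable (smooth_on_derive (0, v) sF)).
have := is_derive_line d1; rewrite g0.
have -> : 'D_(c, 0) ('D_(0, v) F) (0, y) = c *m 'D_v K_chart y.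
  apply: (etrans (derive_comm_mx (c, 0) (0, v) oD sF D0)).
  apply: (etrans (esym (derive_pairr ('D_(c, 0) F) 0 y v))).
  have N : \forall z \near y, 'D_(c, 0) F (0, z) = (fun z => cst c z *m K_chart z) z.
    by apply: (near_open oO Oy) => z Oz; exact: derive_act_chart.
  apply: (etrans (near_eq_derive v N)).
  have dK := smooth_differentiable smooth_K_chart Oy.
  apply: (etrans (derive_mulmx v (differentiable_cst c y) dK)).
  by rewrite derive_cst mul0mx add0r.
have -> // : (fun r : R => 'D_(0, v) F ((0, y) + r *: (c, 0))) =
   (fun s : R => 'D_(0, v) F (s *: c, y)).
apply/funext => s.
by rewrite -[(0, y) + s *: (c, 0)]/(0 + s *: c, y + s *: 0) scaler0 addr0 add0r.
Qed.

End ToricChart.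

(** * Infinitesimal form of torus invariance in a chart *)

Section LieDerivatives.
Context {R : realType} {m : nat} {M : topologicalType} (T : toric_manifold R m M).
Variable q : M.
Local Notation A := (tm_atlas T).
Local Notation act := (tm_act T).
Local Notation cdm p := (cdom (chart_at A p)).
Local Notation phi p := (cmap (chart_at A p)).
Local Notation psi p := (cinv (chart_at A p)).
Local Notation O := (in_chart A q [set: M]).
Local Notation F := (act_chart T q q).
Local Notation Kq := (K_chart T q).

Lemma derive_flow_point y c : O y ->
  is_derive (0 : R) 1 (fun s : R => F (s *: c, y)) (c *m Kq y).
Proof.
move=> Oy; have D0 := act_dom0 Oy.
have sF := @act_chart_smooth R m M T q q.
have g0 : (0, y) + (0 : R) *: (c, 0) = (0, y) :> 'rV[R]_m * 'rV[R]_(m + m).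
  by rewrite scale0r addr0.
have d1 : derivable F ((0, y) + (0 : R) *: (c, 0)) (c, 0).
  by rewrite g0; apply: diff_derivable; exact: (smooth_differentiable sF).
have := is_derive_line d1; rewrite g0 (derive_act_chart c Oy).
have -> // : (fun r : R => F ((0, y) + r *: (c, 0))) = (fun s : R => F (s *: c, y)).
apply/funext => s.
by rewrite -[(0, y) + s *: (c, 0)]/(0 + s *: c, y + s *: 0) scaler0 addr0 add0r.
Qed.

Lemma near_act_dom y c : O y -> \forall s \near (0 : R), act_dom T q q (s *: c, y).
Proof.
move=> Oy.
have N : \forall z \near ((0 : R) *: c, y), act_dom T q q z.
  rewrite scale0r.
  by apply: open_nbhs_nbhs; split; [exact: open_act_dom|exact: act_dom0].
have d : differentiable (fun s : R => (s *: c, y)) (0 : R).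
  by apply: differentiable_pair; [exact: ex_diff|exact: differentiable_cst].
have C := differentiable_continuous d.
exact: (C _ N).
Qed.

Lemma derive_flow_comp k l y c (f : 'rV[R]_(m + m) -> 'M[R]_(k, l)) : O y ->
  differentiable f y ->
  is_derive (0 : R) 1 (fun s : R => f (F (s *: c, y))) ('D_(c *m Kq y) f y).
Proof.
move=> Oy df; have [/derivable1_diffP dF eF] := derive_flow_point c Oy.
have F0 : F ((0 : R) *: c, y) = y.
  by rewrite scale0r /act_chart /= act0x cinvK.
have df' : differentiable f (F ((0 : R) *: c, y)) by rewrite F0.
have dfF := differentiable_comp dF df'.
split; first exact: diff_derivable.
have E := derive_comp (1 : R) dF df'.
apply: (etrans E). 
by rewrite eF F0.
Qed.

(** L_K J = 0, obtained by differentiating at s = 0 the relation between [J] and the linearized flow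
    of s -> act (s c); [derive_flow] supplies the derivative of that linearized flow. *)
Lemma LieK_endo_chart (J : M -> 'M[R]_(m + m)) y c x :
  (forall theta p, J p *m tangent_map A (act theta) p
     = tangent_map A (act theta) p *m J (act theta p)) ->
  smooth_endo A setT J -> O y ->
  x *m 'D_(c *m Kq y) (endo_in_chart A J q) y =
  c *m 'D_(x *m endo_in_chart A J q y) Kq y
    - c *m 'D_x Kq y *m endo_in_chart A J q y.
Proof.
move=> Jinv sJ Oy; set Jq := endo_in_chart A J q.
have [/derivable1_diffP d1 e1] := derive_flow c (x *m Jq y) Oy.
have [/derivable1_diffP d2 e2] := derive_flow c x Oy.
have dJ : differentiable Jq y := smooth_differentiable (sJ q) Oy.
have [/derivable1_diffP d3 e3] := derive_flow_comp c Oy dJ.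
have N : \forall s \near (0 : R), 'D_(0, x *m Jq y) F (s *: c, y) =
    (fun s : R => 'D_(0, x) F (s *: c, y) *m Jq (F (s *: c, y))) s.
  apply: (filterS _ (near_act_dom c Oy)) => s ds.
  apply: (etrans (derive_act_chart_dir (x *m Jq y) ds)).
  apply: (etrans _ (esym (congr1 (mulmx^~ _) (derive_act_chart_dir x ds)))).
  case: (ds) => _ qx'.
  exact: (etrans (esym (mulmxA x _ _))
    (etrans (congr1 (mulmx x) (endo_chart_act Jinv Oy qx')) (mulmxA x _ _))).
have E := etrans (esym e1) (etrans (near_eq_derive (1 : R) N) (derive_mulmx (1 : R) d2 d3)).
rewrite e2 e3 in E.
have F0 : F ((0 : R) *: c, y) = y by rewrite scale0r /act_chart /= act0x cinvK.
have h0 : 'D_(0, x) F ((0 : R) *: c, y) = x by rewrite scale0r; exact: derive_act_chart0.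
have solve (a b h x0 : 'rV[R]_(m + m)) (j' j d : 'M[R]_(m + m)) :
    a = b *m j' + h *m d -> h = x0 -> j' = j -> x0 *m d = a - b *m j.
  by move=> -> -> ->; rewrite addrAC subrr add0r.
exact: solve E h0 (congr1 Jq F0).
Qed.

Lemma LieK_K_chart y c e : O y ->
  c *m 'D_(e *m Kq y) Kq y = e *m 'D_(c *m Kq y) Kq y.
Proof.
move=> Oy.
have [/derivable1_diffP d1 e1] := derive_flow c (e *m Kq y) Oy.
have dK : differentiable Kq y := smooth_differentiable (smooth_K_chart (q := q)) Oy.
have [/derivable1_diffP d3 e3] := derive_flow_comp c Oy dK.
have N : \forall s \near (0 : R), 'D_(0, e *m Kq y) F (s *: c, y) =
    (fun s : R => cst e s *m Kq (F (s *: c, y))) s.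
  apply: (filterS _ (near_act_dom c Oy)) => s ds.
  apply: (etrans (derive_act_chart_dir (e *m Kq y) ds)).
  case: (ds) => _ qx'.
  exact: (etrans (esym (mulmxA e _ _)) (congr1 (mulmx e) (K_chart_act Oy qx'))).
have E := etrans (esym e1) (etrans (near_eq_derive (1 : R) N)
  (derive_mulmx (1 : R) (differentiable_cst _ _) d3)).
by rewrite e3 derive_cst mul0mx add0r in E.
Qed.

End LieDerivatives.

(** * The deformed structure *)

Section DeformCalculus.
Context {R : realType} {m n : nat}.
Implicit Types (J : 'M[R]_n) (K : 'M[R]_(m, n)) (D : 'M[R]_(n, m)).

Lemma gram_conj (a a' : 'M[R]_n) J K D : a' *m a = 1%:M ->
  gram (a *m J *m a') (K *m a') (a *m D) = gram J K D.
Proof.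
move=> E; rewrite /gram !mulmxA -(mulmxA K a') E mulmx1.
by rewrite -(mulmxA (K *m J) a') E mulmx1.
Qed.

(** [deform] is tensorial, because [gram] is a matrix of scalars independent of the frame. Hence the
    deformation may be computed from the components in any one chart. *)
Lemma deform_conj C t (a a' : 'M[R]_n) J K D : a' *m a = 1%:M ->
  deform C t (a *m J *m a') (K *m a') (a *m D) = a *m deform C t J K D *m a'.
Proof.
move=> E; rewrite /deform gram_conj//; move: (resolvent _ _ _)^T => b.
rewrite !mulmxDr !mulmxDl -!scalemxAr -!scalemxAl !mulmxA.
by rewrite -!(mulmxA _ a' a) E !mulmx1.
Qed.

Variables (V : normedModType R) (O : set V).
Hypothesis oO : open O.
Variables (J : V -> 'M[R]_n) (K : V -> 'M[R]_(m, n)) (D : V -> 'M[R]_(n, m)).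
Hypotheses (sJ : smooth_on O J) (sK : smooth_on O K) (sD : smooth_on O D).
Variables (C : 'M[R]_m) (t : R).
Local Notation G z := (gram (J z) (K z) (D z)).
Local Notation B z := (resolvent C (G z) t).
Hypothesis uG : forall z, O z -> 1%:M + t *: (G z *m C) \in unitmx.

Lemma smooth_gram : smooth_on O (fun z => G z).
Proof.
have s := smooth_on_scalemx oO (-1) (smooth_on_mulmx oO (smooth_on_mulmx oO sK sJ) sD).
by apply: (smooth_on_eq oO _ s) => z Oz; rewrite scaleN1r.
Qed.

Lemma smooth_resolvent : smooth_on O (fun z => B z).
Proof.
apply: (smooth_on_mulmx oO); first exact: smooth_on_cst.
apply: (smooth_on_invmx oO) => //.
apply: (smooth_on_addmx oO); first exact: smooth_on_cst.
apply: (smooth_on_scalemx oO); apply: (smooth_on_mulmx oO); first exact: smooth_gram.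
exact: smooth_on_cst.
Qed.

Lemma smooth_deform : smooth_on O (fun z => deform C t (J z) (K z) (D z)).
Proof.
have sb := smooth_on_trmx oO smooth_resolvent.
have sC : smooth_on O (fun=> C^T) by exact: smooth_on_cst.
apply: (smooth_on_addmx oO).
  apply: (smooth_on_addmx oO) => //; apply: (smooth_on_scalemx oO).
  exact: (smooth_on_mulmx oO (smooth_on_mulmx oO sD sC) sK).
apply: (smooth_on_scalemx oO).
exact: (smooth_on_mulmx oO (smooth_on_mulmx oO (smooth_on_mulmx oO
  (smooth_on_mulmx oO sJ sD) sb) sK) sJ).
Qed.

Lemma derive_gram z v : O z -> 'D_v (fun z => G z) z =
  - (('D_v K z *m J z + K z *m 'D_v J z) *m D z + K z *m J z *m 'D_v D z).
Proof.
move=> Oz.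
have dJ := smooth_differentiable sJ Oz; have dK := smooth_differentiable sK Oz.
have dD := smooth_differentiable sD Oz.
have dKJ := differentiable_mulmx dK dJ; have dKJD := differentiable_mulmx dKJ dD.
apply: (etrans (deriveN (diff_derivable (v := v) dKJD))); congr (- _).
apply: (etrans (derive_mulmx v dKJ dD)); congr (_ *m _ + _).
exact: derive_mulmx.
Qed.

Let S := t *: C^T.
Let b z := t *: (B z)^T.

Lemma deformE z : deform C t (J z) (K z) (D z) =
  J z + D z *m S *m K z + J z *m D z *m b z *m (K z *m J z).
Proof.
by rewrite /deform /S /b -!scalemxAr -!scalemxAl !mulmxA.
Qed.

Lemma smooth_b : smooth_on O b.
Proof. exact: (smooth_on_scalemx oO t (smooth_on_trmx oO smooth_resolvent)). Qed.

Lemma derive_deform z v : O z ->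
  'D_v (fun z => deform C t (J z) (K z) (D z)) z =
  'D_v J z + ('D_v D z *m S *m K z + D z *m S *m 'D_v K z)
  + (('D_v J z *m D z + J z *m 'D_v D z) *m b z *m (K z *m J z)
     + J z *m D z *m 'D_v b z *m (K z *m J z)
     + J z *m D z *m b z *m ('D_v K z *m J z + K z *m 'D_v J z)).
Proof.
move=> Oz.
have dJ := smooth_differentiable sJ Oz; have dK := smooth_differentiable sK Oz.
have dD := smooth_differentiable sD Oz; have db := smooth_differentiable smooth_b Oz.
have dS : differentiable (fun _ : V => S) z := differentiable_cst S z.
have dDS := differentiable_mulmx dD dS; have dDSK := differentiable_mulmx dDS dK.
have dJD := differentiable_mulmx dJ dD; have dJDb := differentiable_mulmx dJD db.
have dKJ := differentiable_mulmx dK dJ; have dQ := differentiable_mulmx dJDb dKJ.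
have dJP := differentiableD dJ dDSK.
have -> : (fun z => deform C t (J z) (K z) (D z)) =
    (J + (fun z => D z *m S *m K z)) + (fun z => J z *m D z *m b z *m (K z *m J z)).
  by apply/funext => z'; rewrite deformE.
apply: (etrans (deriveD (diff_derivable (v := v) dJP) (diff_derivable (v := v) dQ))).
congr (_ + _).
  apply: (etrans (deriveD (diff_derivable (v := v) dJ) (diff_derivable (v := v) dDSK))).
  congr (_ + _); apply: (etrans (derive_mulmx v dDS dK)); congr (_ *m _ + _).
  apply: (etrans (derive_mulmx v dD dS)).
  by rewrite derive_cst mulmx0 addr0.
apply: (etrans (derive_mulmx v dJDb dKJ)).
have e1 := etrans (derive_mulmx v dJD db)
  (congr1 (fun u => u *m _ + _) (derive_mulmx v dJ dD)).
have e2 := congr1 (mulmx (J z *m D z *m b z)) (derive_mulmx v dK dJ).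
apply: (etrans (f_equal2 +%R (congr1 (mulmx^~ _) e1) e2)).
by rewrite mulmxDl.
Qed.

Hypothesis bS : forall z, O z -> b z + b z *m G z *m S = S.
Hypothesis uS : forall z, O z -> 1%:M + G z *m S \in unitmx.

(** Differentiating b + b G S = S gives b' (1 + G S) = - b G' S. Substituting S = b (1 + G S) on the
    right allows the invertible factor to be cancelled. *)
Lemma derive_b z v : O z -> 'D_v b z = - (b z *m 'D_v (fun z => G z) z *m b z).
Proof.
move=> Oz.
have dG := smooth_differentiable smooth_gram Oz.
have db := smooth_differentiable smooth_b Oz.
have dS : differentiable (fun _ : V => S) z := differentiable_cst S z.
have dbG := differentiable_mulmx db dG; have dbGS := differentiable_mulmx dbG dS.
have N : \forall z' \near z, cst S z' = (b + (fun z => b z *m G z *m S)) z'.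
  by apply: (near_open oO Oz) => z' Oz'; rewrite -[LHS](bS Oz').
have E := etrans (esym (derive_cst S z v)) (etrans (near_eq_derive v N)
  (etrans (deriveD (diff_derivable (v := v) db) (diff_derivable (v := v) dbGS))
  (congr1 (fun u => _ + u) (etrans (derive_mulmx v dbG dS)
    (congr1 (fun u => u *m _ + _) (derive_mulmx v db dG)))))).
rewrite derive_cst mulmx0 addr0 in E.
have H := bS Oz; have U := uS Oz; move: E H U.
move: ('D_v (fun z => G z) z) ('D_v b z) (b z) (G z) => g' d' b0 g0 E H U.
have E' : d' *m (1%:M + g0 *m S) = - (b0 *m g' *m b0) *m (1%:M + g0 *m S).
  rewrite mulNmx -[in RHS](mulmxA _ b0) [b0 *m (1%:M + _)]mulmxDr mulmx1 (mulmxA b0 g0) H.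
  apply/eqP; rewrite -addr_eq0 mulmxDr mulmx1; apply/eqP.
  by apply: etrans (esym E); rewrite mulmxDl !mulmxA addrA.
by rewrite -(mulmxK U d') E' mulmxK.
Qed.

End DeformCalculus.

(** * Integrability in terms of first jets *)

Section Integrability.
Context {R : realType} {n : nat} {M : topologicalType} (A : @atlas R n M).
Local Notation O q := (in_chart A q [set: M]).

Lemma endo_chart_square (J : M -> 'M[R]_n) q y : O q y ->
  (forall p, J p *m J p = - 1%:M) ->
  endo_in_chart A J q y *m endo_in_chart A J q y = - 1%:M.
Proof.
move=> Oy JJ; have qx := cinv_cdom Oy; have xx := chart_at_mem A (cinv (chart_at A q) y).
rewrite /endo_in_chart /=.
move: (transitionK xx qx) (transitionK qx xx) (JJ (cinv (chart_at A q) y)).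
move: (transition A q _ _) (transition A _ q _) (J _) => a b j ba ab jj.
by rewrite !mulmxA -(mulmxA _ b) ba mulmx1 -(mulmxA a j) jj mulmxN mulmx1 mulNmx ab.
Qed.

Lemma integrable_jet (J : M -> 'M[R]_n) q y : smooth_endo A setT J ->
  (forall p, J p *m J p = - 1%:M) -> integrable_acs A setT J -> O q y ->
  let Jq := endo_in_chart A J q in
  forall x z, nijenhuis_jet (Jq y) (fun v => 'D_v Jq y) x z =
    nijenhuis_jet (Jq y) (fun v => 'D_v Jq y) z x.
Proof.
move=> sJ JJ iJ Oy Jq x z; have oO := @open_in_chart _ _ _ A q.
have sx : smooth_on (O q) (fun=> x) by exact: smooth_on_cst.
have sz : smooth_on (O q) (fun=> z) by exact: smooth_on_cst.
have dJ := smooth_differentiable (sJ q) Oy.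
have := iJ q _ _ sx sz y Oy.
rewrite (nijenhuisE dJ (smooth_differentiable sx Oy) (smooth_differentiable sz Oy)
  (endo_chart_square Oy JJ)).
by move/eqP; rewrite subr_eq0 => /eqP.
Qed.

Lemma jet_integrable (J : M -> 'M[R]_n) : smooth_endo A setT J ->
  (forall p, J p *m J p = - 1%:M) ->
  (forall q y, O q y -> let Jq := endo_in_chart A J q in
   forall x z, nijenhuis_jet (Jq y) (fun v => 'D_v Jq y) x z =
    nijenhuis_jet (Jq y) (fun v => 'D_v Jq y) z x) ->
  integrable_acs A setT J.
Proof.
move=> sJ JJ jJ q X Y sX sY y Oy.
have dJ := smooth_differentiable (sJ q) Oy.
rewrite (nijenhuisE dJ (smooth_differentiable sX Oy) (smooth_differentiable sY Oy)
  (endo_chart_square Oy JJ)).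
by rewrite (jJ q y Oy) subrr.
Qed.

Lemma nijenhuis_jet_opp k (j : 'M[R]_k) (dj : 'rV[R]_k -> 'M[R]_k) x y :
  (forall v, dj (- v) = - dj v) ->
  nijenhuis_jet (- j) (fun v => - dj v) x y = nijenhuis_jet j dj x y.
Proof.
by move=> djN; rewrite /nijenhuis_jet !mulmxN djN !mulNmx !opprK mulmxN opprK.
Qed.

(** Needed for the adjoint - J_(-t). Both terms of the jet are quadratic in the structure and its
    derivative, so the sign disappears. *)
Lemma integrable_opp (J : M -> 'M[R]_n) : smooth_endo A setT J ->
  (forall p, J p *m J p = - 1%:M) -> integrable_acs A setT J ->
  integrable_acs A setT (fun p => - J p).
Proof.
move=> sJ JJ iJ.
have NE q : endo_in_chart A (fun p => - J p) q = - endo_in_chart A J q.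
  apply/funext => y.
  exact: (etrans (congr1 (mulmx^~ _) (mulmxN _ _)) (mulNmx _ _)).
apply: jet_integrable => [q|p|q y Oy Nq x z].
- have s := smooth_on_scalemx (@open_in_chart _ _ _ A q) (-1) (sJ q).
  by apply: (smooth_on_eq (@open_in_chart _ _ _ A q) _ s) => y Oy; rewrite NE scaleN1r.
- by rewrite mulNmx mulmxN opprK.
- have dJ := smooth_differentiable (sJ q) Oy.
  have DE v : 'D_v Nq y = - 'D_v (endo_in_chart A J q) y.
    rewrite /Nq NE; exact: (deriveN (diff_derivable (v := v) dJ)).
  have DN v : 'D_(- v) (endo_in_chart A J q) y = - 'D_v (endo_in_chart A J q) y.
    by have := derive_linear_dir (-1) v 0 dJ; rewrite !scaleN1r derive0 !addr0.
  have EN : nijenhuis_jet (Nq y) (fun v => 'D_v Nq y) =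
      nijenhuis_jet (endo_in_chart A J q y) (fun v => 'D_v (endo_in_chart A J q) y).
    have -> : (fun v => 'D_v Nq y) = (fun v => - 'D_v (endo_in_chart A J q) y).
      exact/funext.
    have -> : Nq y = - endo_in_chart A J q y by rewrite /Nq NE.
    by apply/funext => a; apply/funext => b; exact: nijenhuis_jet_opp.
  have H := integrable_jet sJ JJ iJ Oy x z.
  exact: (etrans (congr1 (fun f => f x z) EN) (etrans H (esym (congr1 (fun f => f z x) EN)))).
Qed.

End Integrability.

Lemma deform_equivariant (R : realType) m n C t (J J' a : 'M[R]_n)
    (K K' : 'M[R]_(m, n)) (D D' : 'M[R]_(n, m)) :
  K *m a = K' -> a *m D' = D -> J *m a = a *m J' ->
  deform C t J K D *m a = a *m deform C t J' K' D'.
Proof.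
move=> kE dE jE.
have gE : gram J' K' D' = gram J K D.
  by rewrite /gram -kE -dE -(mulmxA K a) -jE !mulmxA.
rewrite /deform gE; move: (resolvent _ _ _)^T => b.
rewrite -kE -dE !mulmxDl !mulmxDr -!scalemxAl -!scalemxAr jE; congr (_ + _ *: _ + _ *: _).
  by rewrite !mulmxA.
by rewrite !mulmxA jE -!(mulmxA _ J a) jE !mulmxA.
Qed.

Section ToricDeformation.
Context {R : realType} {m : nat} {M : topologicalType} (T : toric_manifold R m M).
Variable J : M -> 'M[R]_(m + m).
Hypothesis hJ : Kahler T [set: M] J.
Variable C : 'M[R]_m.
Hypothesis CT : C^T = - C.
Local Notation A := (tm_atlas T).
Local Notation act := (tm_act T).
Local Notation mu := (tm_mu T).
Local Notation w := (tm_omega T).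
Local Notation D := (differential A mu).
Local Notation psi p := (cinv (chart_at A p)).
Local Notation tr p r x := (transition A p r x).
Local Notation O q := (in_chart A q [set: M]).
Local Notation KM := (K_span T).

Definition toric_deform (t : R) (p : M) : 'M[R]_(m + m) := deform C t (J p) (KM p) (D p).

Let wT p : (w p)^T = - w p. Proof. exact: (symp_alt (tm_symplectic T)). Qed.
Let wU p : w p \in unitmx. Proof. exact: (symp_nondeg (tm_symplectic T)). Qed.
Let JJ p : J p *m J p = - 1%:M. Proof. exact: (gk_square hJ.1). Qed.
Let DE p : D p = w p *m (KM p)^T. Proof. exact: omega_K_span. Qed.
Let KD p : KM p *m D p = 0. Proof. exact: K_span_D. Qed.
Let tamed p v : v != 0 -> 0 < bilin (w p) v (v *m J p).
Proof. by move=> v0; exact: (gk_tamed hJ.1). Qed.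

Lemma Kahler_compatible p : J p *m w p = - (w p *m (J p)^T).
Proof.
have := hJ.2 p I; rewrite /omega_adj => /(congr1 trmx).
rewrite trmxK linearN /= => /(congr1 (mulmx (w p))).
by rewrite mulmxA mulKVmx// mulmxN.
Qed.

Let Jw := Kahler_compatible.

Local Notation G p := (gram (J p) (KM p) (D p)).

Let unitG p t : 1%:M + t *: (G p *m C) \in unitmx.
Proof. exact: (unit_1GC (wT p) (Jw p) (DE p) (@tamed p) CT). Qed.

Lemma toric_deform_square t p : toric_deform t p *m toric_deform t p = - 1%:M.
Proof.
exact: (deform_square (wT p) (JJ p) (Jw p) (DE p) (KD p) (@tamed p) CT).
Qed.

Lemma toric_deform_adj t : omega_adj T (toric_deform t) = fun p => - toric_deform (- t) p.
Proof.
apply/funext => p.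
exact: (deform_adj (wT p) (wU p) (Jw p) (DE p) (@tamed p) CT).
Qed.

Lemma toric_deform_tamed t p v : v != 0 -> 0 < bilin (w p) v (v *m toric_deform t p).
Proof.
exact: (deform_tamed (wT p) (Jw p) (DE p) (@tamed p) CT).
Qed.

Lemma toric_deform_invariant t theta p :
  toric_deform t p *m tangent_map A (act theta) p =
  tangent_map A (act theta) p *m toric_deform t (act theta p).
Proof.
have kE := K_span_equivariant T theta p; have dE := D_equivariant T theta p.
exact: (deform_equivariant C t kE dE (gk_invariant hJ.1 theta I)).
Qed.

Lemma toric_deform_chart t q y : O q y -> endo_in_chart A (toric_deform t) q y =
  deform C t (endo_in_chart A J q y) (K_chart T q y) (D_chart T q y).
Proof.
move=> Oy; have qx := cinv_cdom Oy; have xx := chart_at_mem A (psi q y).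
rewrite (D_chartE Oy); apply: (esym (deform_conj C t _ _ _ (transitionK xx qx))).
Qed.

Lemma gram_chart q y : O q y ->
  gram (endo_in_chart A J q y) (K_chart T q y) (D_chart T q y) = G (psi q y).
Proof.
move=> Oy; have qx := cinv_cdom Oy; have xx := chart_at_mem A (psi q y).
rewrite (D_chartE Oy); apply: (gram_conj _ _ _ (transitionK xx qx)).
Qed.

Let unitG_chart t q y : O q y ->
  1%:M + t *: (gram (endo_in_chart A J q y) (K_chart T q y) (D_chart T q y) *m C)
    \in unitmx.
Proof. by move=> Oy; rewrite gram_chart. Qed.

Let sJ q : smooth_on (O q) (endo_in_chart A J q). Proof. exact: (gk_smooth hJ.1). Qed.

Lemma toric_deform_smooth t : smooth_endo A setT (toric_deform t).
Proof.
move=> q; have oO := @open_in_chart _ _ _ A q.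
have s := smooth_deform oO (@sJ q) (smooth_K_chart (q := q)) (smooth_D_chart (q := q))
  (@unitG_chart t q).
by apply: (smooth_on_eq oO _ s) => y Oy; rewrite toric_deform_chart.
Qed.

Let bS t p : let b := t *: (resolvent C (G p) t)^T in
  b + b *m G p *m (t *: C^T) = t *: C^T.
Proof.
have := tr_resolventr (wT p) (Jw p) (DE p) (@tamed p) CT t.
move: (resolvent _ _ _)^T => b; move: (G p) => g E /=.
rewrite CT -!scalemxAl -!scalemxAr mulmxN scalerN -E scalerBr.
by rewrite scalerN.
Qed.

Lemma toric_deform_integrable t : integrable_acs A setT (toric_deform t).
Proof.
apply: jet_integrable => [|p|q y Oy Nq x z].
- exact: toric_deform_smooth.
- exact: toric_deform_square.
have oO := @open_in_chart _ _ _ A q.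
pose Jq := endo_in_chart A J q; pose Kq := K_chart T q; pose Dq := D_chart T q.
have sK : smooth_on (O q) Kq := smooth_K_chart (q := q).
have sD : smooth_on (O q) Dq := smooth_D_chart (q := q).
have dJ : differentiable Jq y := smooth_differentiable (@sJ q) Oy.
have dK := smooth_differentiable sK Oy.
have dD := smooth_differentiable sD Oy.
pose b u := t *: (resolvent C (gram (Jq u) (Kq u) (Dq u)) t)^T.
have morph_derive (W : normedModType R) (f : 'rV[R]_(m + m) -> W) :
    differentiable f y -> {morph (fun v => 'D_v f y) : u v / u + v}.
  by move=> df u v; have := derive_linear_dir 1 u v df; rewrite !scale1r.
have dKD v : 'D_v Kq y *m Dq y + Kq y *m 'D_v Dq y = 0.
  have N : \forall u \near y, cst 0 u = (fun u => Kq u *m Dq u) u.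
    by apply: (near_open oO Oy) => u Ou; exact: (esym (K_chart_D Ou)).
  apply: (etrans (esym (derive_mulmx v dK dD))).
  exact: (etrans (esym (near_eq_derive v N)) (derive_cst _ _ _)).
(* Closedness of dmu, as the symmetry of the second derivatives of [mu] in the chart. *)
have dD_sym u v : v *m 'D_u Dq y = u *m 'D_v Dq y.
  have smu : smooth_on (O q) (mu \o psi q).
    exact: (@mm_smooth _ _ _ _ _ _ _ _ (tm_moment T) q).
  have E a c : c *m 'D_a Dq y = 'D_a ('D_c (mu \o psi q)) y.
    have N : \forall z \near y, 'D_c (mu \o psi q) z = (fun z => cst c z *m Dq z) z.
      apply: (near_open oO Oy) => z' Oz'.
      exact: (deriveEjacobian c (smooth_differentiable smu Oz')).
    apply: esym; apply: (etrans (near_eq_derive a N)).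
    apply: (etrans (derive_mulmx a (differentiable_cst c y) dD)).
    by rewrite derive_cst mul0mx add0r.
  exact: (etrans (E u v) (etrans (derive_comm_mx u v oO smu Oy) (esym (E v u)))).
have NJ : forall u v, nijenhuis_jet (Jq y) (fun v => 'D_v Jq y) u v =
    nijenhuis_jet (Jq y) (fun v => 'D_v Jq y) v u.
  exact: (integrable_jet (gk_smooth hJ.1) JJ (gk_integrable hJ.1) Oy).
have bSq u : O q u -> b u + b u *m gram (Jq u) (Kq u) (Dq u) *m (t *: C^T) = t *: C^T.
  by move=> Ou; rewrite /b /Jq /Kq /Dq (gram_chart Ou); exact: bS.
have uS u : O q u -> 1%:M + gram (Jq u) (Kq u) (Dq u) *m (t *: C^T) \in unitmx.
  move=> Ou; rewrite /Jq /Kq /Dq (gram_chart Ou) CT -scalemxAr mulmxN scalerN -scaleNr.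
  exact: unitG.
have dbE v := derive_b oO (@sJ q) sK sD (@unitG_chart t q) bSq uS v Oy.
have dGE v := derive_gram (@sJ q) sK sD v Oy.
have JtE : Nq y = Jq y + Dq y *m (t *: C^T) *m Kq y + Jq y *m Dq y *m b y *m (Kq y *m Jq y).
  exact: (etrans (toric_deform_chart t Oy) (deformE _ _ _ _ _ _)).
have dJtE v : 'D_v Nq y = 'D_v Jq y
   + ('D_v Dq y *m (t *: C^T) *m Kq y + Dq y *m (t *: C^T) *m 'D_v Kq y)
   + (('D_v Jq y *m Dq y + Jq y *m 'D_v Dq y) *m b y *m (Kq y *m Jq y)
     + Jq y *m Dq y *m 'D_v b y *m (Kq y *m Jq y)
     + Jq y *m Dq y *m b y *m ('D_v Kq y *m Jq y + Kq y *m 'D_v Jq y)).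
  have N : \forall z \near y, Nq z = deform C t (Jq z) (Kq z) (Dq z).
    by apply: (near_open oO Oy) => z' Oz'; exact: toric_deform_chart.
  apply: (etrans (near_eq_derive v N)).
  exact: (derive_deform oO (@sJ q) sK sD (@unitG_chart t q) v Oy).
have H := @nijenhuis_jet_deform R m (m + m) (Jq y) (Kq y) (Dq y) (t *: C^T) (b y)
  (fun v => 'D_v Jq y) (fun v => 'D_v Kq y) (fun v => 'D_v Dq y) (fun v => 'D_v b y)
  (morph_derive _ _ dJ) (morph_derive _ _ dK) (morph_derive _ _ dD)
  (endo_chart_square Oy JJ) (K_chart_D Oy) dKD dD_sym
  (fun c x => LieK_endo_chart c x (fun theta p => gk_invariant hJ.1 theta I) (gk_smooth hJ.1) Oy)
  (fun c e => LieK_K_chart c e Oy) NJ (bSq y Oy).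
have dbE' v := etrans (dbE v) (congr1 (fun g => - (b y *m g *m b y)) (dGE v)).
have dJtF : (fun v => 'D_v Nq y) = _ := funext dJtE.
have E : nijenhuis_jet (Nq y) (fun v => 'D_v Nq y) = _ :=
  f_equal2 (@nijenhuis_jet R (m + m)) JtE dJtF.
exact: (etrans (congr1 (fun f => f x z) E) (etrans (H dbE' x z)
  (esym (congr1 (fun f => f z x) E)))).
Qed.

Lemma toric_deform_DGK t : DGK T setT (toric_deform t).
Proof.
split; first split.
- exact: toric_deform_smooth.
- by move=> p _; exact: toric_deform_square.
- by move=> p v _; exact: toric_deform_tamed.
- exact: toric_deform_integrable.
- rewrite toric_deform_adj; apply: integrable_opp.
  + exact: toric_deform_smooth.
  + exact: toric_deform_square.
  + exact: toric_deform_integrable.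
- by move=> theta p _; exact: toric_deform_invariant.
move=> p _; rewrite toric_deform_adj mulmxN.
pose f s := 1%:M - s *: (G p *m (resolvent C (G p) s)^T).
have KdE s : KM p *m toric_deform s p = f s *m (KM p *m J p).
  exact: (K_deform _ _ (KD p)).
have fU s : row_full (f s).
  have := tr_resolventr (wT p) (Jw p) (DE p) (@tamed p) CT s.
  rewrite row_full_unit /f; move: (resolvent _ _ _)^T => b; move: (G p) => g E.
  (* The inverse is explicit: this product is 1 by [tr_resolventr]. So J_t and its adjoint both map
     the span of the K_i onto that of the J_0 K_i. *)
  have /mulmx1_unit[] // : (1%:M - s *: (g *m b)) *m (1%:M - s *: (g *m C)) = 1%:M.
  rewrite mulmxBl mul1mx mulmxBr mulmx1 -!scalemxAl -!scalemxAr.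
  have -> : g *m b *m (g *m C) = g *m (b *m g *m C) by rewrite !mulmxA.
  rewrite -scalerBr (scalemxAr s g (b *m g *m C)) -mulmxBr E mulmxN scalerN opprK.
  by rewrite subrK.
rewrite !KdE; apply/eqmxP.
apply: (eqmx_trans (eqmx_opp _)).
exact: (eqmx_trans (eqmxMfull _ (fU _)) (eqmx_sym (eqmxMfull _ (fU _)))).
Qed.

End ToricDeformation.

(** * Comparison in momentum-angle coordinates *)

Lemma sum_col_row (R : realType) m n (P : 'M[R]_m) (D : 'M[R]_(n, m)) (K : 'M[R]_(m, n)) :
  \sum_i \sum_j P i j *: (col j D *m row i K) = D *m P^T *m K.
Proof.
apply/matrixP => k l; rewrite summxE mxE; apply: eq_bigr => i _.
rewrite summxE mxE mulr_suml; apply: eq_bigr => j _.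
by rewrite mxE [in LHS]mxE big_ord1 !mxE mulrCA mulrA.
Qed.

Lemma jacobian_entry (R : realType) k l (f : 'rV[R]_k -> 'rV[R]_l) x i j :
  differentiable f x ->
  jacobian f x i j = 'D_(delta_mx 0 i) (fun y => f y 0 j : R^o) x.
Proof.
move=> df; apply: esym; apply: (etrans (derive_entry _ _ _ df)).
by rewrite (deriveEjacobian _ df) -rowE mxE.
Qed.

(** Rows of [U] and [K] are d/dmu^j and d/dt^j, columns of [D] and [E] the dual forms, and [H] is
    the Hessian. Then G = H^-1 and J = D H K - E H^-1 U; the term with [C] changes the first block,
    and by the Woodbury formula the term with [B] changes H^-1 into the inverse of H + tC. *)
Lemma deform_frame (R : realType) m n (J : 'M[R]_n) (K U : 'M[R]_(m, n))
    (D E : 'M[R]_(n, m)) (H C : 'M[R]_m) t :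
  J *m J = - 1%:M -> D *m U + E *m K = 1%:M -> U *m D = 1%:M -> K *m D = 0 ->
  U *m J = H *m K -> H \in unitmx -> (gram J K D)^T = gram J K D -> C^T = - C ->
  (resolvent C (gram J K D) t)^T - t *: (C *m gram J K D *m (resolvent C (gram J K D) t)^T) = - C ->
  deform C t J K D = D *m (H + t *: C)^T *m K - E *m (invmx (H + t *: C))^T *m U.
Proof.
move=> JJ DU UD KD UJ HU gT CT.
have KJ : K *m J = - (invmx H *m U).
  have : U *m J *m J = - U by rewrite -mulmxA JJ mulmxN mulmx1.
  rewrite UJ -mulmxA => /(congr1 (mulmx (invmx H))).
  by rewrite mulKmx// mulmxN.
have gE : gram J K D = invmx H.
  by rewrite /gram KJ mulNmx opprK -mulmxA UD mulmx1.
have HT : H^T = H.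
  by rewrite -[H]invmxK trmx_inv -gE gT.
have JE : J = D *m H *m K - E *m invmx H *m U.
  rewrite -[LHS]mul1mx -DU mulmxDl -!mulmxA UJ KJ mulmxN.
  by rewrite !mulmxA.
have JD : J *m D = - (E *m invmx H).
  by rewrite {1}JE mulmxBl -!mulmxA KD UD !mulmx0 mulmx1 sub0r.
have HCT : (H + t *: C)^T = H - t *: C.
  by rewrite linearD linearZ /= HT CT scalerN.
rewrite gE /deform gE; move: (resolvent _ _ _)^T => b bE.
have inv : (invmx (H + t *: C))^T = invmx H - t *: (invmx H *m b *m invmx H).
  have E1 : (H + t *: C)^T *m (invmx H - t *: (invmx H *m b *m invmx H)) = 1%:M.
    have E2 : t *: (C *m invmx H) - t *: (t *: (C *m invmx H *m b *m invmx H))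
        = - (t *: (b *m invmx H)).
      have e : C - t *: (C *m invmx H *m b) = - b.
        by move: (t *: _) bE => X XE; entrywise.
      by rewrite -scalerBr (scalemxAl t (C *m invmx H *m b)) -mulmxBl e mulNmx scalerN.
    rewrite HCT mulmxBl !mulmxBr mulmxV// -!scalemxAl -!scalemxAr !mulmxA mulmxV// mul1mx.
    by rewrite E2 opprK subrK.
  have [uH _] := mulmx1_unit E1.
  by rewrite trmx_inv -[LHS]mulmx1 -E1 mulKmx.
have Q : J *m D *m b *m K *m J = E *m invmx H *m b *m invmx H *m U.
  by rewrite JD -(mulmxA _ K J) KJ !mulNmx mulmxN opprK !mulmxA.
rewrite Q inv HCT [in LHS]JE CT !mulmxBr !mulmxBl mulmxN mulNmx scalerN.
rewrite -!scalemxAr -!scalemxAl !mulmxA.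
by apply/matrixP => k l; rewrite !addmxE !oppmxE !addmxE !oppmxE; ring.
Qed.

Lemma mul1_submx (R : pzRingType) k l (P Q : 'M[R]_(k + l)) : P *m Q = 1%:M ->
  usubmx P *m lsubmx Q = 1%:M /\ dsubmx P *m rsubmx Q = 1%:M.
Proof.
by rewrite -{1}[P]vsubmxK -{1}[Q]hsubmxK mul_col_row scalar_mx_block => /eq_block_mx[].
Qed.

Lemma dsubmx_invmx (R : comUnitRingType) k l (X : 'M[R]_(k + l)) (P : 'M[R]_(l, k + l)) :
  X \in unitmx -> P *m X = row_mx 0 1%:M -> P = dsubmx (invmx X).
Proof.
move=> XU PX; rewrite -[LHS](mulmxK XU) PX -{1}[invmx X]vsubmxK mul_row_col.
by rewrite mul0mx mul1mx add0r.
Qed.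

Section MomentumAngle.
Context {R : realType} {m : nat} {M : topologicalType} (T : toric_manifold R m M).
Variable J : M -> 'M[R]_(m + m).
Hypothesis hJ : Kahler T [set: M] J.
Variable F : momentum_angle_frame T J.
Local Notation A := (tm_atlas T).
Local Notation mu := (tm_mu T).
Local Notation D := (differential A mu).
Local Notation psi p := (cinv (chart_at A p)).
Local Notation phi p := (cmap (chart_at A p)).

Lemma differential_row_mxl k l (f : M -> 'rV[R]_k) (g : M -> 'rV[R]_l) p :
  differentiable (f \o psi p) (phi p p) ->
  differentiable ((fun x => row_mx (f x) (g x)) \o psi p) (phi p p) ->
  lsubmx (differential A (fun x => row_mx (f x) (g x)) p) = differential A f p.
Proof.
move=> df dfg; apply/matrixP => i j; rewrite mxE.
apply: (etrans (jacobian_entry i (lshift l j) dfg)).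
apply: (etrans _ (esym (jacobian_entry i j df))).
have E : (fun y => ((fun x => row_mx (f x) (g x)) \o psi p) y 0 (lshift l j) : R^o) =
    (fun y => (f \o psi p) y 0 j : R^o).
  by apply/funext => y; rewrite /= row_mxEl.
exact: (congr1 (fun h => derive h (phi p p) (delta_mx 0 i)) E).
Qed.

Lemma differential_row_mxr k k' l (f : M -> 'rV[R]_k) (f' : M -> 'rV[R]_k')
    (g : M -> 'rV[R]_l) p :
  differentiable ((fun x => row_mx (f x) (g x)) \o psi p) (phi p p) ->
  differentiable ((fun x => row_mx (f' x) (g x)) \o psi p) (phi p p) ->
  rsubmx (differential A (fun x => row_mx (f x) (g x)) p) =
  rsubmx (differential A (fun x => row_mx (f' x) (g x)) p).
Proof.
move=> df df'; apply/matrixP => i j; rewrite [LHS]mxE [RHS]mxE.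
apply: (etrans (jacobian_entry i (rshift k j) df)).
apply: (etrans _ (esym (jacobian_entry i (rshift k' j) df'))).
have E : (fun y => ((fun x => row_mx (f x) (g x)) \o psi p) y 0 (rshift k j) : R^o) =
    (fun y => ((fun x => row_mx (f' x) (g x)) \o psi p) y 0 (rshift k' j) : R^o).
  by apply/funext => y; rewrite /= !row_mxEr.
exact: (congr1 (fun h => derive h (phi p p) (delta_mx 0 i)) E).
Qed.

(** The hypothesis [ma_dt] identifies d/dt^j with K_j only in the coordinates (u, t). The covectors
    dt^j do not change when u is replaced by mu, and dmu (K_j) = 0, so the K_j are also the d/dt^j
    of (mu, t). *)
Lemma frame_dual p : M_int T p ->
  exists U E, [/\ forall j, d_dmu F j p = row j U, forall j, d_dt F j p = row j (K_span T p),
    forall j, dt F j p = col j E,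
    D p *m U + E *m K_span T p = 1%:M & U *m D p = 1%:M].
Proof.
move=> /(frame_coordinates F) [V [u [t [Vp hV hF]]]].
pose mut := fun x => row_mx (mu x) (t x); pose ut := fun x => row_mx (u x) (t x).
pose X := differential A mut p; pose Y := differential A ut p.
have [_ smut _ Xu] := ma_symplectic hV; have [_ sut _ Yu] := ma_complex hV.
have XU : X \in unitmx := Xu p Vp; have YU : Y \in unitmx := Yu p Vp.
have inV : in_chart A p V (phi p p) by exists p => //; split=> //; exact: chart_at_mem.
have dmut : differentiable (mut \o psi p) (phi p p) := smooth_differentiable (smut p) inV.
have dut : differentiable (ut \o psi p) (phi p p) := smooth_differentiable (sut p) inV.
have dmu := mu_differentiable (chart_at_mem A p).
have XD : lsubmx X = D p := differential_row_mxl dmu dmut.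
have XY : rsubmx X = rsubmx Y := differential_row_mxr dmut dut.
have KY : K_span T p = dsubmx (invmx Y).
  apply/row_matrixP => j; rewrite rowK -(ma_dt hV j Vp) /coord_vector.
  by apply/rowP => k; rewrite !mxE.
have KE : K_span T p *m rsubmx X = 1%:M.
  by rewrite KY XY; have [_] := mul1_submx (mulVmx YU).
have KX : K_span T p *m X = row_mx 0 1%:M.
  by rewrite -[X]hsubmxK mul_mx_row XD K_span_D KE.
have KE' : K_span T p = dsubmx (invmx X).
  exact: dsubmx_invmx XU KX.
have XV := mulmxV XU; have VX := mulVmx XU.
exists (usubmx (invmx X)), (rsubmx X); split.
- move=> j; have [-> _ _] := hF p j Vp.
  by apply/rowP => k; rewrite !mxE.
- move=> j; have [_ -> _] := hF p j Vp; rewrite KE'.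
  by apply/rowP => k; rewrite !mxE.
- move=> j; have [_ _ ->] := hF p j Vp.
  by apply/colP => k; rewrite !mxE.
- by rewrite KE' -XD -mul_row_col hsubmxK vsubmxK.
- by rewrite -XD; have [] := mul1_submx VX.
Qed.

Variable tau : 'rV[R]_m -> R^o.
Hypothesis htau_convex : strictly_convex_on (interior (polytope T)) tau.
Hypothesis hJ0tau : forall p j, M_int T p ->
  d_dmu F j p *m J p = \sum_(k < m) hessian tau (mu p) j k *: d_dt F k p.

Lemma hessian_unit p : M_int T p -> hessian tau (mu p) \in unitmx.
Proof.
move=> ip; rewrite -row_free_unit -kermx_eq0; apply/eqP/row_matrixP => i; rewrite row0.
set v := row i _.
have vH : v *m hessian tau (mu p) = 0 by rewrite /v -row_mul mulmx_ker row0.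
apply/eqP; apply: contraT => v0.
by have := htau_convex ip v0; rewrite /bilin vH mul0mx mxE ltxx.
Qed.

Lemma toric_deform_int C t p : C^T = - C -> M_int T p ->
  toric_deform T J C t p = J_int F (Psi tau C t) p.
Proof.
move=> CT ip; have [U [E [hU hK hE DU UD]]] := frame_dual ip.
have wT := symp_alt (tm_symplectic T) p.
have tamed v : v != 0 -> 0 < bilin (tm_omega T p) v (v *m J p).
  by move=> v0; exact: (gk_tamed hJ.1).
have Jw := Kahler_compatible hJ p.
have UJ : U *m J p = hessian tau (mu p) *m K_span T p.
  apply/row_matrixP => j; rewrite row_mul -hU hJ0tau// row_mul mulmx_sum_row.
  by apply: eq_bigr => k _; rewrite hK; congr (_ *: _); rewrite [RHS]mxE.
rewrite /toric_deform (deform_frame (gk_square hJ.1 I) DU UD (K_span_D T p) UJ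
  (hessian_unit ip) (gram_sym wT Jw (omega_K_span T p)) CT
  (tr_resolventl wT Jw (omega_K_span T p) tamed CT t)).
rewrite /J_int /Psi -!sum_col_row; congr (_ - _).
  by apply: eq_bigr => i _; apply: eq_bigr => j _; rewrite hK.
by apply: eq_bigr => i _; apply: eq_bigr => j _; rewrite hE hU.
Qed.

End MomentumAngle.

Theorem corollary1 (R : realType) (m : nat) (M : topologicalType)
    (T : toric_manifold R m M)
    (J0 : M -> 'M[R]_(m + m)) (hJ0 : Kahler T [set: M] J0)
    (F : momentum_angle_frame T J0)
    (tau : 'rV[R]_m -> R^o)
    (htau : smooth_on (interior (polytope T)) tau)
    (htau_convex : strictly_convex_on (interior (polytope T)) tau)
    (hJ0tau : forall (p : M) (j : 'I_m), M_int T p ->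
       d_dmu F j p *m J0 p
       = \sum_(k < m) hessian tau (tm_mu T p) j k *: d_dt F k p)
    (C : 'M[R]_m) (hC : C^T = - C) :
  exists2 eps : R, 0 < eps &
    exists J : R -> M -> 'M[R]_(m + m),
      forall t : R, `|t| < eps ->
        DGK T [set: M] (J t) /\
        forall p : M, M_int T p -> J t p = J_int F (Psi tau C t) p.
Proof.
(* The radius 1 is arbitrary, [toric_deform_DGK] and [toric_deform_int] being valid for all [t]. *)
exists 1 => //; exists (toric_deform T J0 C) => t _; split.
  exact: toric_deform_DGK.
by move=> p ip; exact: toric_deform_int.
Qed.
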